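(* Let $\mathcal{V}$ be a simple Euclidean Jordan algebra of rank $n$. Then every pointed spectral cone in $\mathcal{V}$ is irreducible.
   Context: A Euclidean Jordan algebra is a finite-dimensional real inner product space $(\mathcal{V},\langle\cdot,\cdot\rangle)$ with a commutative bilinear product $\circ$ having a unit element $e$ and satisfying $x\circ(x^2\circ y)=x^2\circ(x\circ y)$ and $\langle x\circ y,z\rangle=\langle y,x\circ z\rangle$ for all $x,y,z$, where $x^2=x\circ x$. An idempotent is an element $c$ with $c\circ c=c$; it is primitive if it is nonzero and not a sum of two nonzero idempotents. A Jordan frame is a finite set $\{e_1,\dots,e_n\}$ of primitive idempotents with $e_i\circ e_j=0$ for $i\ne j$ and $e_1+\cdots+e_n=e$; all Jordan frames have the same number $n$ of elements, called the rank of $\mathcal{V}$. Every $x\in\mathcal{V}$ has a spectral decomposition $x=q_1e_1+\cdots+q_ne_n$ with $\{e_1,\dots,e_n\}$ a Jordan frame and $q_i\in\mathbb{R}$; the numbers $q_1,\dots,q_n$ (with multiplicity) depend only on $x$ and are called the eigenvalues of $x$. The eigenvalue map $\lambda:\mathcal{V}\to\mathbb{R}^n$ sends $x$ to the vector of its eigenvalues written in decreasing order. $\mathcal{V}$ is simple if it is nonzero and is not a direct product of nonzero Euclidean Jordan algebras (equivalently, has no non-trivial ideal). A nonempty set $Q\subseteq\mathbb{R}^n$ is permutation invariant if $\sigma(Q)=Q$ for every $n\times n$ permutation matrix $\sigma$. A nonempty set $K$ in a real vector space is a convex cone if it is convex and $tx\in K$ for all $x\in K$ and all real $t\ge 0$;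 it is pointed if in addition $K\cap -K=\{0\}$. A spectral cone in $\mathcal{V}$ is a set of the form $\lambda^{-1}(Q)$ where $Q\subseteq\mathbb{R}^n$ is a permutation invariant convex cone (such a set is known to be a convex cone in $\mathcal{V}$). A convex cone $K$ is reducible if $K=K_1+K_2$ for some nonzero convex cones $K_1,K_2$ (i.e. $K_i\neq\{0\}$) with $\operatorname{span}(K_1)\cap\operatorname{span}(K_2)=\{0\}$; a convex cone that is not reducible is irreducible. Cones are not assumed closed. *)

(* Defs.v *)
From HB Require Import structures.
From mathcomp Require Import all_boot all_order perm all_algebra.
From mathcomp Require Import boolp classical_sets reals convex.

Set Implicit Arguments.
Unset Strict Implicit.
Unset Printing Implicit Defensive.

Import Order.TTheory GRing.Theory Num.Theory.
Local Open Scope classical_set_scope.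
Local Open Scope ring_scope.

(* Linearity is only required in the first argument of [jmul] and [inner];
   commutativity and symmetry give the other one. The zero algebra is allowed,
   with [jone = 0]. *)
HB.mixin Record isEuclideanJordan (R : realType) V of Vector R V := {
  jmul : V -> V -> V;
  jone : V;
  inner : V -> V -> R;
  jmulC : commutative jmul;
  jmulPl : forall (a : R) (x y z : V),
    jmul (a *: x + y) z = a *: jmul x z + jmul y z;
  jmul1x : left_id jone jmul;
  jordan_identity : forall x y : V,
    jmul x (jmul (jmul x x) y) = jmul (jmul x x) (jmul x y);
  innerC : forall x y : V, inner x y = inner y x;
  innerPl : forall (a : R) (x y z : V),
    inner (a *: x + y) z = a * inner x z + inner y z;
  inner_gt0 : forall x : V, x != 0 -> 0 < inner x x;
  inner_jmul : forall x y z : V, inner (jmul x y) z = inner y (jmul x z)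
}.

#[short(type="euclideanJordanType")]
HB.structure Definition EuclideanJordan (R : realType) :=
  { V of isEuclideanJordan R V & Vector R V }.

Section BilinearInstances.
Context (R : realType) (V : euclideanJordanType R).

Fact jmul_is_bilinear : bilinear_for
  (GRing.Scale.Law.clone _ _ *:%R _) (GRing.Scale.Law.clone _ _ *:%R _)
  (@jmul R V).
Proof.
split=> [z a x y|z a x y] /=; first exact: jmulPl.
by rewrite jmulC jmulPl !(jmulC z).
Qed.

HB.instance Definition _ :=
  bilinear_isBilinear.Build R V V V *:%R *:%R (@jmul R V) jmul_is_bilinear.

Fact inner_is_bilinear : bilinear_for
  (GRing.Scale.Law.clone _ _ *%R _)
  (GRing.Scale.Law.clone _ _ (idfun \; *%R) _) (@inner R V).
Proof.
split=> [z a x y|z a x y] /=; first exact: innerPl.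
by rewrite innerC innerPl !(innerC z).
Qed.

HB.instance Definition _ :=
  bilinear_isBilinear.Build R V V R *%R (idfun \; *%R) (@inner R V)
    inner_is_bilinear.

Fact inner_is_hermitian : forall x y : V,
  inner x y = (-1) ^+ false * idfun (inner y x).
Proof. by move=> x y; rewrite mul1r innerC. Qed.

HB.instance Definition _ :=
  isHermitianSesquilinear.Build R V false idfun (@inner R V)
    inner_is_hermitian.

HB.instance Definition _ :=
  isDotProduct.Build R V (@inner R V) (@inner_gt0 R V).

End BilinearInstances.

Section DirectProduct.
Context (R : realType) (V1 V2 : euclideanJordanType R).
Implicit Types x y z : (V1 * V2)%type.

Definition prod_jmul x y : V1 * V2 := (jmul x.1 y.1, jmul x.2 y.2).
Definition prod_jone : V1 * V2 := (jone, jone).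
Definition prod_inner x y : R := inner x.1 y.1 + inner x.2 y.2.

Fact prod_jmulC : commutative prod_jmul.
Proof. by move=> x y; congr (_, _); exact: jmulC. Qed.

Fact prod_jmulPl (a : R) x y z :
  prod_jmul (a *: x + y) z = a *: prod_jmul x z + prod_jmul y z.
Proof. by congr (_, _); exact: jmulPl. Qed.

Fact prod_jmul1x : left_id prod_jone prod_jmul.
Proof. by move=> [x1 x2]; congr (_, _); exact: jmul1x. Qed.

Fact prod_jordan_identity x y :
  prod_jmul x (prod_jmul (prod_jmul x x) y) =
  prod_jmul (prod_jmul x x) (prod_jmul x y).
Proof. by congr (_, _); exact: jordan_identity. Qed.

Fact prod_innerC x y : prod_inner x y = prod_inner y x.
Proof. by congr (_ + _); exact: innerC. Qed.

Fact prod_innerPl (a : R) x y z :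
  prod_inner (a *: x + y) z = a * prod_inner x z + prod_inner y z.
Proof. by rewrite /prod_inner /= !innerPl mulrDr addrACA. Qed.

Fact prod_inner_gt0 x : x != 0 -> 0 < prod_inner x x.
Proof.
have inner_ge0 (V : euclideanJordanType R) (v : V) : 0 <= inner v v.
  have [->|/inner_gt0/ltW//] := eqVneq v 0.
  by have := innerPl (-1) (0 : V) 0 0; rewrite scaler0 addr0 mulN1r addNr => ->.
case: x => x1 x2 x0; rewrite /prod_inner /=.
have [x10|/inner_gt0 x1_gt0] := eqVneq x1 0; last exact: ltr_pwDl.
apply: ltr_wpDl => //; apply: inner_gt0; apply: contraNneq x0 => ->.
by rewrite x10.
Qed.

Fact prod_inner_jmul x y z :
  prod_inner (prod_jmul x y) z = prod_inner y (prod_jmul x z).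
Proof. by congr (_ + _); exact: inner_jmul. Qed.

HB.instance Definition _ := isEuclideanJordan.Build R (V1 * V2)%type
  prod_jmulC prod_jmulPl prod_jmul1x prod_jordan_identity
  prod_innerC prod_innerPl prod_inner_gt0 prod_inner_jmul.

End DirectProduct.

Section EuclideanJordanTheory.
Context (R : realType).

(* An isomorphism of unital algebras that is also an isometry. Asking for the
   isometry makes no difference to simplicity: an algebra isomorphism
   V -> V1 * V2 carries the inner product of V to one for which V1 and V2 are
   orthogonal, since <x, y> = <x o e1, y> = <x, e1 o y> = 0. *)
Definition eja_iso (V W : euclideanJordanType R) (f : {linear V -> W}) : Prop :=
  [/\ bijective f, {morph f : x y / jmul x y}
    & forall x y : V, inner (f x) (f y) = inner x y].

Definition eja_nonzero (V : euclideanJordanType R) : Prop := exists x : V, x != 0.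

Definition eja_simple (V : euclideanJordanType R) : Prop :=
  eja_nonzero V /\
  ~ exists V1 V2 : euclideanJordanType R,
      [/\ eja_nonzero V1, eja_nonzero V2
        & exists f : {linear V -> (V1 * V2)%type}, eja_iso f].

Definition jidempotent (V : euclideanJordanType R) (c : V) : Prop := jmul c c = c.

Definition primitive_idempotent (V : euclideanJordanType R) (c : V) : Prop :=
  [/\ jidempotent c, c != 0
    & ~ exists c1 c2 : V, [/\ jidempotent c1, jidempotent c2,
          c1 != 0, c2 != 0 & c = c1 + c2]].

(* The members of the family are pairwise distinct, being nonzero and
   orthogonal, so that a frame indexed by 'I_n is a set of n elements. *)
Definition jordan_frame (V : euclideanJordanType R) (n : nat)
    (e : 'I_n -> V) : Prop :=
  [/\ forall i, primitive_idempotent (e i),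
      forall i j, i != j -> jmul (e i) (e j) = 0
    & \sum_(i < n) e i = jone].

Definition eja_rank (V : euclideanJordanType R) (n : nat) : Prop :=
  (exists e : 'I_n -> V, jordan_frame e) /\
  (forall (m : nat) (e : 'I_m -> V), jordan_frame e -> m = n).

Definition eigenvalue_vectors (V : euclideanJordanType R) (n : nat) (x : V)
    : set 'cV[R]_n :=
  [set q | (forall i j : 'I_n, (i <= j)%N -> q j 0 <= q i 0) /\
           exists2 e : 'I_n -> V, jordan_frame e
             & x = \sum_(i < n) q i 0 *: e i].

(* When [n] is the rank of [V], [eigenvalue_vectors n x] is a singleton, by the
   spectral theorem and the uniqueness of eigenvalues; [eigenvalue_map n x] is
   its element, and the default value 0 of [xget] is then never used. *)
Definition eigenvalue_map (V : euclideanJordanType R) (n : nat) (x : V)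
    : 'cV[R]_n :=
  xget 0 (@eigenvalue_vectors V n x).

End EuclideanJordanTheory.

Section Cones.
Context (R : realType).

Definition permutation_invariant (n : nat) (Q : set 'cV[R]_n) : Prop :=
  Q !=set0 /\ forall s : 'S_n, [set perm_mx s *m q | q in Q] = Q.

Definition convex_cone (E : lmodType R) (K : set E) : Prop :=
  [/\ K !=set0, convex_set (K : set (convex_lmodType E))
    & forall (t : R) (x : E), 0 <= t -> K x -> K (t *: x)].

Definition pointed_cone (E : lmodType R) (K : set E) : Prop :=
  convex_cone K /\ K `&` [set - x | x in K] = [set 0].

Definition spectral_cone (V : euclideanJordanType R) (n : nat) (K : set V)
    : Prop :=
  exists Q : set 'cV[R]_n,
    [/\ permutation_invariant Q, convex_cone Q
      & K = @eigenvalue_map R V n @^-1` Q].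

Definition span_set (E : vectType R) (K : set E) : set E :=
  [set x | exists2 s : seq E, {in s, forall y, K y} & x \in <<s>>%VS].

Definition reducible_cone (E : vectType R) (K : set E) : Prop :=
  convex_cone K /\
  exists K1 K2 : set E,
    [/\ convex_cone K1 /\ K1 <> [set 0],
        convex_cone K2 /\ K2 <> [set 0],
        span_set K1 `&` span_set K2 = [set 0]
      & K = [set x + y | x in K1 & y in K2]].

Definition irreducible_cone (E : vectType R) (K : set E) : Prop :=
  convex_cone K /\ ~ reducible_cone K.

End Cones.

(* Main.v *)
From HB Require Import structures.
From mathcomp Require Import all_boot all_order perm all_algebra.
From mathcomp Require Import boolp classical_sets reals interval_inference.
From mathcomp Require Import unstable convex complex.
From mathcomp Require Import lra ring.
Require Import Defs.

(* Suppose [K = K1 + K2], let [P] be the projection on [span K1] along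
   [span K2], and let [u = s e] be the sum of all the permutations of the
   eigenvalues of some nonzero [y] in [K]; [s <> 0] as [K] is pointed. An
   algebra automorphism [phi] preserves [K], so [K] also decomposes along the
   projection [phi P phi^-1]. Two decompositions of a pointed cone are
   compatible, and projections that are compatible and close to each other
   agree; hence [phi (P u) = P u] for [phi] in a suitable continuous family
   through the identity. The automorphisms used are products of two reflections
   [x |-> 2 w (w x) - x] with [w^2 = e], where [w] moves on a rational curve
   that rotates a given spectral idempotent of [P u] towards its Peirce space
   1/2; "close" becomes the nonvanishing of a polynomial in the parameter. So
   the spectral idempotents of [P u] have no Peirce space 1/2, and [P u] is a
   multiple of [e] by simplicity. Therefore [P e] is [0] or [e]. If [P e = 0],
   take [x] in [K1] and let [z] be the sum of the other permutations of its
   eigenvalues, so that [x + z] is a multiple of [e]: then [x + P z = 0] with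
   both terms in [K], so [x = 0]. The other case is symmetric. *)

Set Implicit Arguments.
Unset Strict Implicit.
Unset Printing Implicit Defensive.

Import Order.TTheory GRing.Theory Num.Theory.
Local Open Scope classical_set_scope.
Local Open Scope ring_scope.

Local Notation "x ** y" := (jmul x y) (at level 40, left associativity).

(** * Jordan identities and the Peirce decomposition *)

Section JordanIdentities.
Context (R : realType) (V : euclideanJordanType R).
Implicit Types (a b : R) (c w x y z : V).

Lemma jmulDl x y z : (x + y) ** z = x ** z + y ** z.
Proof. exact: linearDl. Qed.
Lemma jmulDr x y z : x ** (y + z) = x ** y + x ** z.
Proof. exact: linearDr. Qed.
Lemma jmulNl x z : (- x) ** z = - (x ** z).
Proof. exact: linearNl. Qed.
Lemma jmulNr x z : x ** (- z) = - (x ** z).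
Proof. exact: linearNr. Qed.
Lemma jmulZl a x z : (a *: x) ** z = a *: (x ** z).
Proof. exact: linearZl_LR. Qed.
Lemma jmulZr a x z : x ** (a *: z) = a *: (x ** z).
Proof. exact: linearZr_LR. Qed.
Lemma jmulMnl x z n : (x *+ n) ** z = (x ** z) *+ n.
Proof. exact: linearMnl. Qed.
Lemma jmulMnr x z n : x ** (z *+ n) = (x ** z) *+ n.
Proof. exact: linearMnr. Qed.
Lemma jmul0l x : 0 ** x = 0 :> V.
Proof. exact: linear0l. Qed.
Lemma jmul0r x : x ** 0 = 0 :> V.
Proof. exact: linear0r. Qed.
Lemma jmulx1 x : x ** jone = x.
Proof. by rewrite jmulC jmul1x. Qed.

Lemma innerDl x y z : inner (x + y) z = inner x z + inner y z.
Proof. exact: linearDl. Qed.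
Lemma innerNl x z : inner (- x) z = - inner x z.
Proof. exact: linearNl. Qed.
Lemma innerZl a x z : inner (a *: x) z = a * inner x z.
Proof. exact: linearZl_LR. Qed.
Lemma inner0l x : inner (0 : V) x = 0.
Proof. exact: linear0l. Qed.
Lemma innerMnl x z n : inner (x *+ n) z = n%:R * inner x z.
Proof. by rewrite -scaler_nat innerZl. Qed.

Lemma inner_inj x y : (forall u, inner x u = inner y u) -> x = y.
Proof.
move=> h; apply/eqP; rewrite -subr_eq0; apply: contraT => /inner_gt0.
by rewrite innerDl innerNl h subrr ltxx.
Qed.

End JordanIdentities.

(* Vector identities are checked after pairing with an arbitrary vector, which
   turns them into linear arithmetic over [R]. *)
Ltac jexpand :=
  rewrite /= ?(jmulDl, jmulDr, jmulNl, jmulNr, jmulZl, jmulZr, jmulMnl,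
               jmulMnr, jmul0l, jmul0r, jmul1x, jmulx1);
  rewrite ?(innerDl, innerNl, innerZl, inner0l, innerMnl).
Ltac jlin := apply: inner_inj => ?; jexpand; lra.
Ltac jlin_from H :=
  let u := fresh "u" in
  apply: inner_inj => u; move: (congr1 (inner^~ u) H); jexpand => ?; lra.

Section JordanIdentities2.
Context (R : realType) (V : euclideanJordanType R).
Implicit Types (a b : R) (c w x y z : V).

(** The part linear in [z] of the Jordan identity at [x + z]. Subtracting the identity at [x - z]
    leaves the odd terms in [z], and the identity at [z] removes the cubic one. *)
Lemma jordan_polar x y z :
  (x ** z) ** (x ** y) *+ 2 + (x ** x) ** (z ** y) =
  z ** ((x ** x) ** y) + x ** ((x ** z) ** y) *+ 2.
Proof.
have h1 := jordan_identity (x + z) y.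
have h2 := jordan_identity (x - z) y.
have h3 := jordan_identity z y.
apply: inner_inj => u.
move: (congr1 (inner^~ u) h1) (congr1 (inner^~ u) h2) (congr1 (inner^~ u) h3).
rewrite /= !(jmulDl, jmulDr, jmulNl, jmulNr, jmulMnl) !(jmulC z x).
jexpand => e1 e2 e3; lra.
Qed.

(** [jordan_polar] solved for one term: multiplication by [x^2 y] is expressed through
    multiplications by [x], [y], [x^2] and [x y]. This drives the induction on powers in
    [jpow_comm]. *)
Lemma jmul_sqr_mul x y z :
  ((x ** x) ** y) ** z =
  ((x ** y) ** (x ** z)) *+ 2 + (x ** x) ** (y ** z)
  - x ** (y ** (x ** z)) *+ 2.
Proof.
have h := jordan_polar x y z.
rewrite (jmulC y z) (jmulC y (x ** z)) (jmulC _ z) (jmulC (x ** y)).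
jlin_from h.
Qed.

End JordanIdentities2.

(** The quadratic representation [2 w (w x) - w^2 x] of [w] in the case [w^2 = jone]. *)
Definition jrefl (R : realType) (V : euclideanJordanType R) (w x : V) : V :=
  2%:R *: (w ** (w ** x)) - x.

(* The Peirce decomposition with respect to an involution [w], i.e. to the
   idempotent [c = (w + e) / 2]: the sum of the Peirce spaces 1 and 0 of [c] is
   [w (w x) = x], and the Peirce space 1/2 is [w x = 0]. *)
Section Involution.
Context (R : realType) (V : euclideanJordanType R) (w : V).
Hypothesis ww : w ** w = jone.
Implicit Types x y z : V.

(** In [jordan_polar] at [w] the two terms with [w^2] cancel. Thus multiplication by [w] commutes
    with multiplication by any element of its image, from which most Peirce rules follow. *)
Lemma inv_jmulA y z : (w ** z) ** (w ** y) = w ** ((w ** z) ** y).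
Proof. by have h := jordan_polar w y z; rewrite ww !jmul1x in h; jlin_from h. Qed.

Lemma inv_jmul3 z : w ** (w ** (w ** z)) = w ** z.
Proof. by have := inv_jmulA w z; rewrite ww jmulx1 (jmulC _ w). Qed.

Lemma even_jmulA y z : w ** (w ** z) = z -> z ** (w ** y) = w ** (z ** y).
Proof. by move=> <-; exact: inv_jmulA. Qed.

Lemma even_even y z : w ** (w ** z) = z -> w ** (w ** y) = y ->
  w ** (w ** (z ** y)) = z ** y.
Proof. by move=> hz hy; rewrite -!even_jmulA // hy. Qed.

Lemma even_odd y z : w ** (w ** z) = z -> w ** y = 0 -> w ** (z ** y) = 0.
Proof. by move=> hz hy; rewrite -even_jmulA // hy jmul0r. Qed.

(** For [z = y] this is [jmul_sqr_mul], whose other terms contain [w z = 0]; polarisation gives the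
    rest. *)
Lemma odd_odd y z : w ** z = 0 -> w ** y = 0 -> w ** (w ** (z ** y)) = z ** y.
Proof.
have sq x : w ** x = 0 -> w ** (w ** (x ** x)) = x ** x.
  move=> hx; rewrite jmulC [w ** (x ** x)]jmulC jmul_sqr_mul ww jmulx1.
  by rewrite (jmulC x w) hx !jmul0r !mul0rn subr0 add0r.
move=> hz hy; have h : w ** (z + y) = 0 by rewrite jmulDr hz hy addr0.
have := sq _ h; have e1 := sq _ hz; have e2 := sq _ hy.
rewrite !(jmulDl, jmulDr) (jmulC y z) e1 e2.
by move=> {}h; jlin_from h.
Qed.

Lemma jreflK : involutive (jrefl w).
Proof.
move=> x; rewrite /jrefl jmulDr jmulNr jmulZr inv_jmul3.
jlin.
Qed.

(** The even and odd parts grade the algebra by Z/2, and [jrefl w] is the identity on the former and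
    the opposite on the latter. *)
Lemma jreflM x y : jrefl w (x ** y) = jrefl w x ** jrefl w y.
Proof.
pose ev x := w ** (w ** x); pose od x := x - ev x.
have hev z : w ** (w ** ev z) = ev z by rewrite /ev inv_jmul3.
have hod z : w ** od z = 0 by rewrite /od jmulDr jmulNr inv_jmul3 subrr.
have rE z : jrefl w z = ev z - od z by rewrite /jrefl /od; jlin.
have dE z : z = ev z + od z by rewrite /od addrC subrK.
have revE z : w ** (w ** z) = z -> jrefl w z = z by move=> h; rewrite /jrefl h; jlin.
have rodE z : w ** z = 0 -> jrefl w z = - z.
  by move=> h; rewrite /jrefl h jmul0r scaler0 add0r.
have rD u v : jrefl w (u + v) = jrefl w u + jrefl w v by rewrite /jrefl; jlin.
clearbody od ev.
rewrite (rE x) (rE y) [in LHS](dE x) [in LHS](dE y).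
rewrite !(jmulDl, jmulDr, jmulNl, jmulNr) !rD.
rewrite (revE (ev x ** ev y)); last exact: even_even.
rewrite (rodE (ev x ** od y)); last exact: even_odd.
rewrite (rodE (od x ** ev y)); last by rewrite (jmulC (od x)); exact: even_odd.
rewrite (revE (od x ** od y)); last exact: odd_odd.
jlin.
Qed.

End Involution.

Section Idempotent.
Context (R : realType) (V : euclideanJordanType R) (c : V).
Hypothesis cc : jidempotent c.
Implicit Types x y z : V.

Let w := 2%:R *: c - jone.

Lemma idem_inv : w ** w = jone.
Proof.
have h : c ** c = c := cc.
by rewrite /w !(jmulDl, jmulDr, jmulZl, jmulZr, jmulNl, jmulNr, h); jlin.
Qed.

Lemma peirce11 x y : c ** x = x -> c ** y = y -> c ** (x ** y) = x ** y.
Proof.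
move=> hx hy; have wx : w ** x = x by rewrite /w jmulDl jmulZl hx; jlin.
have wy : w ** y = y by rewrite /w jmulDl jmulZl hy; jlin.
have := @even_jmulA _ _ w idem_inv y x; rewrite !wx wy => /(_ erefl).
by rewrite /w jmulDl jmulZl => h; jlin_from h.
Qed.

Lemma peirce00 x y : c ** x = 0 -> c ** y = 0 -> c ** (x ** y) = 0.
Proof.
move=> hx hy; have wx : w ** x = - x by rewrite /w jmulDl jmulZl hx; jlin.
have wy : w ** y = - y by rewrite /w jmulDl jmulZl hy; jlin.
have := @even_jmulA _ _ w idem_inv y x.
rewrite !(wx, wy, jmulNr) opprK => /(_ erefl).
by rewrite /w !(jmulDl, jmulZl) => h; jlin_from h.
Qed.

(** Both [x] and [y] are even for [w], so [w (x y)] equals [x (w y) = - x y] as well as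
    [y (w x) = x y]. *)
Lemma peirce10 x y : c ** x = x -> c ** y = 0 -> x ** y = 0.
Proof.
move=> hx hy; have wx : w ** x = x by rewrite /w jmulDl jmulZl hx; jlin.
have wy : w ** y = - y by rewrite /w jmulDl jmulZl hy; jlin.
have := @even_jmulA _ _ w idem_inv y x; rewrite !(wx, wy) => /(_ erefl) h1.
have := @even_jmulA _ _ w idem_inv x y.
rewrite !(wx, wy, jmulNr) opprK => /(_ erefl); rewrite (jmulC y x) -h1.
by rewrite jmulNr => h; jlin_from h.
Qed.

Lemma odd_half x : w ** x = 0 <-> c ** x = 2^-1 *: x.
Proof. by rewrite /w; split=> h; [jlin_from h | rewrite jmulDl jmulZl h; jlin]. Qed.

End Idempotent.

(** * The spectral theorem *)

Section PolyAction.
Context (R : realType) (V : vectType R) (T : {linear V -> V}).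
Implicit Types (p q : {poly R}) (u v : V).

Definition pact p v : V := \sum_(i < size p) p`_i *: iter i T v.

Lemma pact_wide n p v : (size p <= n)%N ->
  pact p v = \sum_(i < n) p`_i *: iter i T v.
Proof.
move=> h; rewrite /pact (big_ord_widen_cond _ predT (fun i => p`_i *: iter i T v) h).
rewrite big_mkcond /=; apply: eq_bigr => i _; case: ltnP => // hi.
by rewrite nth_default // scale0r.
Qed.

Lemma pactD p q v : pact (p + q) v = pact p v + pact q v.
Proof.
pose n := maxn (size p) (size q).
rewrite (@pact_wide n (p + q)) ?size_polyD // (@pact_wide n p) ?leq_maxl //.
rewrite (@pact_wide n q) ?leq_maxr // -big_split /=.
by apply: eq_bigr => i _; rewrite coefD scalerDl.
Qed.

Lemma pactZ a p v : pact (a *: p) v = a *: pact p v.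
Proof.
rewrite (@pact_wide (size p) (a *: p)) ?size_scale_leq // scaler_sumr.
by apply: eq_bigr => i _; rewrite coefZ scalerA.
Qed.

Lemma pactB p q v : pact (p - q) v = pact p v - pact q v.
Proof. by rewrite pactD -scaleN1r pactZ scaleN1r. Qed.

Lemma pact0 v : pact 0 v = 0.
Proof. by rewrite /pact size_poly0 big_ord0. Qed.

Lemma pact_sum I (r : seq I) (F : I -> {poly R}) v :
  pact (\sum_(i <- r) F i) v = \sum_(i <- r) pact (F i) v.
Proof.
exact: (big_morph (pact^~ v) (fun p q => pactD p q v) (pact0 v)).
Qed.

Lemma pactC a v : pact a%:P v = a *: v.
Proof. by rewrite (@pact_wide 1) ?size_polyC_leq1 // big_ord1 coefC. Qed.

Lemma pact1 v : pact 1 v = v.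
Proof. by rewrite -[1]/(1%:P) pactC scale1r. Qed.

Lemma pact_linear p : linear (pact p).
Proof.
move=> a u v; rewrite /pact scaler_sumr -big_split /=; apply: eq_bigr => i _.
have -> : iter i T (a *: u + v) = a *: iter i T u + iter i T v.
  by elim: (i : nat) => //= k ->; rewrite linearP.
by rewrite scalerDr !scalerA mulrC.
Qed.

HB.instance Definition _ p :=
  GRing.isLinear.Build R V V *:%R (pact p) (@pact_linear p).

Lemma pactMX p v : pact (p * 'X) v = T (pact p v).
Proof.
rewrite (@pact_wide (size p).+1); last first.
  by rewrite (leq_trans (size_polyMleq _ _)) // size_polyX addnC.
rewrite big_ord_recl coefMX eqxx scale0r add0r /pact linear_sum.
by apply: eq_bigr => i _; rewrite coefMX /= linearZ.
Qed.

Lemma pactX v : pact 'X v = T v.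
Proof. by rewrite -['X]mul1r pactMX pact1. Qed.

Lemma pactM p q v : pact (p * q) v = pact p (pact q v).
Proof.
elim/poly_ind: p => [|p c IH]; first by rewrite mul0r !pact0.
rewrite mulrDl mulrAC !pactD !pactMX IH; congr (_ + _).
by rewrite mul_polyC pactZ pactC.
Qed.

Lemma pact_eigen p a v : T v = a *: v -> pact p v = p.[a] *: v.
Proof.
move=> h; elim/poly_ind: p => [|p c IH]; first by rewrite pact0 horner0 scale0r.
by rewrite pactD pactMX IH linearZ /= h pactC hornerMXaddC scalerDl scalerA.
Qed.

(** One more iterate of [v] than the dimension of [V] must be linearly dependent. *)
Lemma pact_annihilator v : exists2 p, p != 0 & pact p v = 0.
Proof.
pose n := (\dim {:V}).+1.
pose X := [tuple iter i T v | i < n].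
have : ~~ free X.
  apply/negP; rewrite /free => /eqP h.
  have := dimvS (subvf <<X>>%VS).
  by rewrite h size_tuple ltnn.
move/freeP => h; have [k [hk nk]] : exists k : 'I_n -> R,
    \sum_(i < n) k i *: X`_i = 0 /\ ~ (forall i, k i = 0).
  apply: contrapT => hn; apply: h => k hk; apply: contrapT => nk.
  by apply: hn; exists k.
pose p := \poly_(i < n) (if insub i is Some j then k j else 0).
have pE (i : 'I_n) : p`_i = k i by rewrite coef_poly ltn_ord valK.
exists p.
  by apply/eqP => p0; apply: nk => i; rewrite -pE p0 coef0.
rewrite (@pact_wide n) ?size_poly // -[RHS]hk; apply: eq_bigr => i _.
by rewrite pE (nth_map i) ?size_enum_ord // nth_ord_enum.
Qed.

End PolyAction.

Section Lagrange.
Context (R : realType).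
Implicit Types (s : seq R) (a b : R).

(** Repetitions in [s] do no harm, as each factor is 1 at [a]. If [a] is not in [s], the polynomial
    vanishes on [s]. *)
Definition lagr s a : {poly R} :=
  \prod_(b <- s | b != a) ((a - b)^-1 *: ('X - b%:P)).

Lemma horner_lagr s a b : b \in s -> (lagr s a).[b] = (b == a)%:R.
Proof.
move=> bs; rewrite /lagr horner_prod; have [->|ba] := eqVneq b a.
  rewrite big1_seq // => d /andP[da _].
  by rewrite hornerZ hornerXsubC mulVf // subr_eq0 eq_sym.
by rewrite (big_rem b) //= ba hornerZ hornerXsubC subrr mulr0 mul0r.
Qed.

End Lagrange.

(** * Annihilators under a self-adjoint operator *)

Section SelfAdjoint.
Context (R : realType) (V : euclideanJordanType R) (T : {linear V -> V}).
Hypothesis Tsym : forall x y, inner (T x) y = inner x (T y).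
Implicit Types (p q : {poly R}) (u v : V).

Lemma inner_sqr_ge0 v : 0 <= inner v v.
Proof. by have [->|/inner_gt0/ltW//] := eqVneq v 0; rewrite inner0l. Qed.

Lemma inner_sqr_eq0 v : inner v v = 0 -> v = 0.
Proof. by move=> h; apply/eqP; apply: contraT => /inner_gt0; rewrite h ltxx. Qed.

Lemma pact_sym p u v : inner (pact T p u) v = inner u (pact T p v).
Proof.
elim/poly_ind: p u v => [|p c IH] u v.
  by rewrite !pact0 inner0l innerC inner0l.
have pX : pact T (p * 'X) v = pact T p (T v) by rewrite pactM pactX.
rewrite !pactD pX pactMX !pactC.
by rewrite innerDl Tsym IH [RHS]innerC innerDl !innerZl !(innerC _ u).
Qed.

Lemma pact_sqr_inj a v :
  pact T (('X - a%:P) ^+ 2) v = 0 -> pact T ('X - a%:P) v = 0.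
Proof.
by rewrite expr2 pactM => h; apply: inner_sqr_eq0; rewrite -pact_sym h inner0l.
Qed.

(** Pairing the hypothesis with [v] gives [|(T - a) v|^2 + b^2 |v|^2 = 0]. *)
Lemma pact_quad_inj a b v : b != 0 ->
  pact T (('X - a%:P) ^+ 2 + (b ^+ 2)%:P) v = 0 -> v = 0.
Proof.
move=> b0 /(congr1 (inner^~ v)); rewrite pactD pactC expr2 pactM.
rewrite innerDl innerZl inner0l pact_sym => h; apply: inner_sqr_eq0.
have h1 := inner_sqr_ge0 (pact T ('X - a%:P) v); have h2 := inner_sqr_ge0 v.
have h3 : 0 <= b ^+ 2 * inner v v by rewrite mulr_ge0 ?sqr_ge0.
have : b ^+ 2 * inner v v = 0 by lra.
by move/eqP; rewrite mulf_eq0 sqrf_eq0 (negPf b0) => /eqP.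
Qed.

(** Here [a + i b] is a root of [p] in the algebraically closed field [R[i]]. If [b != 0], the
    remainder of [p] modulo the quadratic factor has degree at most 1, real coefficients and a
    non-real root, so it is 0. *)
Lemma real_factor p : (1 < size p)%N ->
  exists q, exists a b, p = q * (if b == 0 then 'X - a%:P
    else ('X - a%:P) ^+ 2 + (b ^+ 2)%:P).
Proof.
move=> sp; pose f : {rmorphism R -> R[i]} := real_complex R.
have /closed_rootP[[a b] /rootP rz] : size (map_poly f p) != 1%N.
  by rewrite size_map_poly; case: (size p) sp => [|[]].
have [b0|b0] := eqVneq b 0.
  have /factor_theorem[q ->] : root p a.
    by rewrite -(fmorph_root f); apply/rootP; rewrite b0 in rz.
  by exists q, a, 0; rewrite eqxx.
set d := ('X - a%:P) ^+ 2 + (b ^+ 2)%:P.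
have dz : (map_poly f d).[a +i* b]%C = 0.
  rewrite rmorphD rmorphXn rmorphB /= map_polyX !map_polyC !hornerE /=.
  by apply/eqP; rewrite eq_complex /=; apply/andP; split; apply/eqP => /=; ring.
exists (p %/ d), a, b; rewrite (negPf b0) -/d.
have sd : size d = 3.
  by rewrite /d size_polyDl ?size_exp_XsubC // (leq_ltn_trans (size_polyC_leq1 _)).
have dn0 : d != 0 by rewrite -size_poly_eq0 sd.
rewrite [LHS](divp_eq p d); suff -> : p %% d = 0 by rewrite addr0.
have := ltn_modp p d; rewrite dn0 sd ltnS => sr.
have : (map_poly f (p %% d)).[a +i* b]%C = 0.
  move: rz; rewrite {1}(divp_eq p d) rmorphD rmorphM hornerD hornerM dz.
  by rewrite mulr0 add0r.
rewrite (@horner_coef_wide _ 2) ?size_map_poly // !big_ord_recl big_ord0 /=.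
rewrite !coef_map /= /bump /= addn0 expr0 expr1 mulr1 addr0 => /eqP.
rewrite eq_complex /= => /andP[/eqP h1 /eqP h2].
have r1 : (p %% d)`_1 = 0.
  have : (p %% d)`_1 * b = 0 by move: h2; rewrite !(mulr0, mul0r, addr0, add0r).
  by move/eqP; rewrite mulf_eq0 (negPf b0) orbF => /eqP.
have r0 : (p %% d)`_0 = 0 by move: h1; rewrite r1 !mul0r subr0 addr0.
apply/polyP => -[|[|i]]; rewrite ?r0 ?r1 coef0 //.
by rewrite nth_default // (leq_trans sr).
Qed.

(** Real factors are split off one at a time: the quadratic ones act injectively and are dropped,
    and repeated linear ones are reduced to a single copy. *)
Lemma split_annihilator p v : p != 0 -> pact T p v = 0 ->
  exists2 s : seq R, uniq s & pact T (\prod_(a <- s) ('X - a%:P)) v = 0.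
Proof.
have [n] := ubnP (size p); elim: n p v => // n IH p v sp p0 pv.
have [sp1|sp1] := leqP (size p) 1.
  exists [::] => //; rewrite big_nil pact1; move: pv p0.
  rewrite (size1_polyC sp1) pactC polyC_eq0 => /eqP.
  by rewrite scaler_eq0 => /orP[->|/eqP].
have [q [a [b pE]]] := real_factor sp1.
have q0 : q != 0 by apply: contraNneq p0 => q0; rewrite pE q0 mul0r.
have sqp : (size q < n)%N.
  move: sp; rewrite pE; set d := (X in q * X) => sp.
  have sd : (1 < size d)%N.
    rewrite /d; case: ifP => _; first by rewrite size_XsubC.
    by rewrite size_polyDl ?size_exp_XsubC // (leq_ltn_trans (size_polyC_leq1 _)).
  have d0 : d != 0 by rewrite -size_poly_gt0 (ltn_trans _ sd).
  move: sp; rewrite size_mul // ltnS; apply: leq_trans.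
  by case: (size d) sd => [|[|m]] // _; rewrite !addnS /= ltnS leq_addr.
move: pE; have [b0 pE|b0 pE] := eqVneq b 0.
  move: pv; rewrite pE pactM => /(IH _ _ sqp q0)[s us]; rewrite -pactM => hs.
  have [as_|as_] := boolP (a \in s); last first.
    by exists (a :: s); rewrite /= ?as_ // big_cons mulrC.
  (* The root [a] would now occur twice; [pact_sqr_inj] removes the second copy. *)
  exists s => //; move: hs; rewrite (big_rem a) //= mulrAC -expr2 => h.
  rewrite mulrC -mulrC pactM; apply: pact_sqr_inj.
  by rewrite -pactM.
apply: (IH q v sqp q0); apply: (pact_quad_inj (a := a) b0).
by rewrite -pactM mulrC -pE.
Qed.

Lemma spectral_points v : exists2 s : seq R, uniq s &
  forall p q, {in s, forall a, p.[a] = q.[a]} -> pact T p v = pact T q v.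
Proof.
have [p p0 /(split_annihilator p0)[s us hs]] := pact_annihilator T v.
exists s => // {p0}p q pq; apply/eqP; rewrite -subr_eq0 -pactB.
have : \prod_(a <- s) ('X - a%:P) %| p - q.
  rewrite uniq_roots_dvdp ?uniq_rootsE //; apply/allP => a /pq h.
  by rewrite /root hornerD hornerN h subrr.
by move/dvdpP => [r ->]; rewrite pactM hs linear0.
Qed.

End SelfAdjoint.

(** * Power associativity and spectral idempotents *)

Section JordanPolynomials.
Context (R : realType) (V : euclideanJordanType R).
Implicit Types (x y z : V) (p q : {poly R}).

Fact jmul_linear x : linear (jmul x).
Proof. by move=> a y z; rewrite jmulDr jmulZr. Qed.

HB.instance Definition _ x :=
  GRing.isLinear.Build R V V *:%R (jmul x) (jmul_linear x).

Lemma jmul_suml I (r : seq I) (P : pred I) (F : I -> V) y :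
  (\sum_(i <- r | P i) F i) ** y = \sum_(i <- r | P i) F i ** y.
Proof. by rewrite jmulC linear_sum; apply: eq_bigr => i _; exact: jmulC. Qed.

Definition jpoly x p : V := pact (jmul x) p jone.

(** Multiplications by [x^n] and by [x] commute. The induction carries two consecutive exponents,
    since [jmul_sqr_mul] expands multiplication by [x^(n+2) = x^2 x^n] through those by [x^n] and
    [x^(n+1)]. *)
Lemma jpow_comm x n y : iter n (jmul x) jone ** (x ** y) =
  x ** (iter n (jmul x) jone ** y).
Proof.
pose P n := forall y, iter n (jmul x) jone ** (x ** y) =
  x ** (iter n (jmul x) jone ** y).
suff: P n /\ P n.+1 by case=> + _; exact.
elim: n => [|n [IH1 IH2]]; first by split=> z /=; rewrite ?jmulx1 ?jmul1x.
split=> // z; rewrite ![iter n.+2 _ _]iterS ![iter n.+1 _ _]iterS.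
have -> : x ** (x ** iter n (jmul x) jone) = (x ** x) ** iter n (jmul x) jone.
  by rewrite [RHS]jmulC IH1 [_ ** x]jmulC.
set u := iter n (jmul x) jone.
have IH2' w : (x ** u) ** (x ** w) = x ** ((x ** u) ** w).
  exact: IH2.
have IH1' w : u ** (x ** w) = x ** (u ** w) by exact: IH1.
rewrite !jmul_sqr_mul IH2' !IH1' -!jordan_identity.
by rewrite !(jmulDr, jmulNr, jmulMnr).
Qed.

Lemma pact_comm (T S : {linear V -> V}) p y :
  (forall z, S (T z) = T (S z)) -> S (pact T p y) = pact T p (S y).
Proof.
move=> ST; elim/poly_ind: p => [|p c IH]; first by rewrite !pact0 linear0.
by rewrite !pactD !pactMX !pactC linearD linearZ /= ST IH.
Qed.

Lemma pactXn (T : {linear V -> V}) n y : pact T 'X^n y = iter n T y.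
Proof.
by elim: n => [|n IH]; rewrite ?expr0 ?pact1 // exprSr pactMX IH.
Qed.

Lemma jpoly_pact x p q : jpoly x p ** jpoly x q = pact (jmul x) p (jpoly x q).
Proof.
rewrite {1}/jpoly /pact jmul_suml; apply: eq_bigr => i _ /=.
rewrite jmulZl; congr (_ *: _); rewrite /jpoly.
rewrite (@pact_comm (jmul x) (jmul (iter i (jmul x) jone))); last exact: jpow_comm.
by rewrite /= jmulx1 -!pactXn -!pactM mulrC.
Qed.

Lemma jpolyM x p q : jpoly x (p * q) = jpoly x p ** jpoly x q.
Proof. by rewrite jpoly_pact /jpoly pactM. Qed.

Lemma jpoly1 x : jpoly x 1 = jone.
Proof. exact: pact1. Qed.

Lemma jpolyX x : jpoly x 'X = x.
Proof. by rewrite /jpoly pactX /= jmulx1. Qed.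

Lemma jpolyXM x p : x ** jpoly x p = jpoly x ('X * p).
Proof. by rewrite jpolyM jpolyX. Qed.

(* The spectral theorem for [x], with the spectral idempotents obtained as
   Lagrange polynomials in [x]. *)
Lemma spectral_idempotents x : exists (s : seq R) (l : R -> {poly R}),
  let c a := jpoly x (l a) in
  [/\ uniq s, {in s, forall a, x ** c a = a *: c a},
      {in s &, forall a b, c a ** c b = if a == b then c a else 0},
      \sum_(a <- s) c a = jone & x = \sum_(a <- s) a *: c a].
Proof.
have [s us hs] := spectral_points (T := jmul x) (@inner_jmul _ _ x) jone.
have {}hs p q : {in s, forall a, p.[a] = q.[a]} -> jpoly x p = jpoly x q.
  exact: hs.
exists s, (lagr s) => c.
have xc : {in s, forall a, x ** c a = a *: c a}.
  move=> a ain; rewrite /c jpolyXM -[RHS]pactZ; apply: hs => b bs.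
  rewrite hornerM hornerX hornerZ horner_lagr //.
  by case: eqVneq => [->|]; rewrite ?mulr0.
have s1 : \sum_(a <- s) c a = jone.
  rewrite -(jpoly1 x) /c /jpoly -pact_sum; apply: hs => b bs.
  rewrite horner_sum hornerC (bigD1_seq b) //= horner_lagr // eqxx.
  rewrite big1_seq ?addr0 // => a /andP[ab _].
  by rewrite horner_lagr // eq_sym (negPf ab).
split=> //; last first.
  rewrite -[LHS]jmulx1 -s1 linear_sum; apply: eq_big_seq => a ain.
  exact: xc.
move=> a b ain bin; rewrite /c -jpolyM; case: eqVneq => [->|ab].
  apply: hs => d ds; rewrite hornerM !horner_lagr //.
  by case: (d == b); rewrite ?mulr0 ?mulr1.
transitivity (jpoly x 0); last exact: pact0.
apply: hs => d ds; rewrite hornerM !horner_lagr // horner0.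
by have [->|] := eqVneq d a; rewrite ?mul0r // (negPf ab) mulr0.
Qed.

End JordanPolynomials.

(** * Splitting idempotents into primitive ones *)

Section OrthogonalPrimitives.
Context (R : realType) (V : euclideanJordanType R).
Implicit Types (c x y : V) (s : seq V).

Definition jorth x y := x ** y == 0.

(** Partial Jordan frames, as lists so that they can be concatenated and filtered. *)
Definition orth_primitives s : Prop :=
  {in s, forall x, primitive_idempotent x} /\ pairwise jorth s.

Lemma orth_primitives_absorb s x : orth_primitives s -> x \in s ->
  (\sum_(y <- s) y) ** x = x.
Proof.
elim: s => // y s IH [prim /= /andP[/allP ys ps]]; rewrite inE big_cons jmulDl.
have os : orth_primitives s.
  by split=> // z zs; apply: prim; rewrite inE zs orbT.
have [->|xy /= xs] := eqVneq x y => [_|].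
  have [-> _ _] : primitive_idempotent y by apply: prim; rewrite inE eqxx.
  rewrite jmul_suml big1_seq ?addr0 // => z /= zs.
  by apply/eqP; rewrite /= jmulC; exact: ys.
by rewrite IH // (eqP (ys _ xs)) add0r.
Qed.

Lemma orth_primitives_idem s : orth_primitives s ->
  jidempotent (\sum_(y <- s) y).
Proof.
move=> os; rewrite /jidempotent linear_sum.
by apply: eq_big_seq => y ys; exact: orth_primitives_absorb.
Qed.

(** Orthogonality of the sums suffices: each member lies in the Peirce space 1 of its sum, so
    [peirce10], used twice, passes from the sums to the members. *)
Lemma orth_primitives_cat s1 s2 : orth_primitives s1 -> orth_primitives s2 ->
  (\sum_(y <- s1) y) ** (\sum_(y <- s2) y) = 0 -> orth_primitives (s1 ++ s2).
Proof.
move=> o1 o2 h; split.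
  by move=> x; rewrite mem_cat => /orP[]; [case: o1 => + _ | case: o2 => + _]; exact.
rewrite pairwise_cat; case: (o1) => _ ->; case: (o2) => _ ->; rewrite !andbT.
apply/allrelP => x y xs ys; apply/eqP.
have h1 := orth_primitives_absorb o1 xs; have h2 := orth_primitives_absorb o2 ys.
apply: (peirce10 (orth_primitives_idem o1)) => //.
rewrite jmulC; apply: (peirce10 (orth_primitives_idem o2)) => //.
by rewrite jmulC.
Qed.

(** Induction on the dimension of the Peirce space 1 of [c]. It drops for each summand of
    [c = d1 + d2], because [d2] lies in the space of [c] but not in that of [d1]. *)
Lemma idempotent_primitives c : jidempotent c ->
  exists2 s, orth_primitives s & \sum_(y <- s) y = c.
Proof.
pose f c : 'End(V) := linfun (fun x : V => c ** x - x).
pose U c := lker (f c).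
have fE d x : f d x = d ** x - x.
  rewrite /f; have lin : linear (fun x : V => d ** x - x).
    by move=> a u v; rewrite jmulDr jmulZr; jlin.
  pose L : {linear V -> V} := HB.pack (fun x : V => d ** x - x)
    (GRing.isLinear.Build R V V *:%R _ lin).
  exact: (lfunE L).
have UE d x : x \in U d <-> d ** x = x.
  by rewrite memv_ker fE subr_eq0; split=> [/eqP|->].
have [n] := ubnP (\dim (U c)); elim: n c => // n IH c dc ic.
have [->|c0] := eqVneq c 0; first by exists [::]; rewrite ?big_nil.
have [pc|npc] := pselect (primitive_idempotent c).
  exists [:: c]; last by rewrite big_seq1.
  by split=> // x; rewrite inE => /eqP ->.
have [c1 [c2 [i1 i2 n1 n2 cE]]] : exists c1 c2, [/\ jidempotent c1,
    jidempotent c2, c1 != 0, c2 != 0 & c = c1 + c2].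
  by apply: contrapT => h; apply: npc.
(* Expanding [c^2 = c] leaves [2 c1 c2 = 0]. *)
have o12 : c1 ** c2 = 0.
  have : c ** c = c := ic; rewrite cE !(jmulDl, jmulDr) i1 i2 (jmulC c2 c1) => h.
  jlin_from h.
have o21 : c2 ** c1 = 0 by rewrite jmulC.
have lt d1 d2 : jidempotent d1 -> jidempotent d2 -> d2 != 0 -> d1 ** d2 = 0 ->
    c = d1 + d2 -> (\dim (U d1) < \dim (U c))%N.
  move=> j1 j2 m2 o ce; rewrite ltn_neqAle; have sub : (U d1 <= U c)%VS.
    apply/subvP => x /UE hx; apply/UE; rewrite ce jmulDl hx.
    by rewrite jmulC (peirce10 j1 hx o) addr0.
  rewrite dimvS // andbT (dimv_leqif_eq sub); apply: contra m2 => /eqP UU.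
  have : d2 \in U c by apply/UE; rewrite ce jmulDl o j2 add0r.
  by rewrite -UU => /UE; rewrite o => <-.
have [s1 os1 e1] := IH c1 (leq_trans (lt c1 c2 i1 i2 n2 o12 cE) dc) i1.
have [|s2 os2 e2] := IH c2 (leq_trans (lt c2 c1 i2 i1 n1 o21 _) dc) i2.
  by rewrite addrC.
exists (s1 ++ s2); last by rewrite big_cat /= e1 e2.
by apply: orth_primitives_cat; rewrite ?e1 ?e2.
Qed.

End OrthogonalPrimitives.

(** * Spectral cones *)

Section ConvexCones.
Context (R : realType) (E : lmodType R) (K : set E).
Hypothesis K_cone : convex_cone K.

Lemma cone0 : K 0.
Proof. by case: K_cone => -[x Kx] _ /(_ 0 x (lexx _) Kx); rewrite scale0r. Qed.

Lemma coneZ t x : 0 <= t -> K x -> K (t *: x).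
Proof. by case: K_cone => _ _; apply. Qed.

Lemma coneD x y : K x -> K y -> K (x + y).
Proof.
move=> Kx Ky; have [_ cK _] := K_cone.
have h0 : 0 <= 2^-1 :> R by lra.
have h1 : 2^-1 <= 1 :> R by lra.
pose h : {i01 R} := Itv01 h0 h1.
have := cK x y h; rewrite !inE => /(_ Kx Ky) /(coneZ (ler0n _ 2)).
set z := (X in _ *: X); have -> : 2%:R *: z = x + y; last by [].
rewrite /z /conv /= scalerDr !scalerA /=.
have -> : 2%:R * 2^-1 = 1 :> R by field.
have -> : 2%:R * `1-(2^-1) = 1 :> R by rewrite /onem; field.
by rewrite !scale1r.
Qed.

Lemma cone_sum I (r : seq I) (P : pred I) (F : I -> E) :
  (forall i, P i -> K (F i)) -> K (\sum_(i <- r | P i) F i).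
Proof. by move=> h; apply: big_ind => //; [exact: cone0 | exact: coneD]. Qed.

Lemma pointed_coneN x : pointed_cone K -> K x -> K (- x) -> x = 0.
Proof.
move=> [_ KN] Kx KNx; have : [set 0] x; last by [].
by rewrite -KN; split=> //; exists (- x) => //; rewrite opprK.
Qed.

End ConvexCones.

Section SpectralLists.
Context (R : realType) (V : euclideanJordanType R).
Implicit Types (x y : V) (s : seq V) (L M : seq (R * V)).

(** A spectral decomposition with no prescribed order or length, so that it can be built before the
    rank is brought in. *)
Definition spectral_list x L := [/\ orth_primitives (map snd L),
  \sum_(u <- L) u.2 = jone & x = \sum_(u <- L) u.1 *: u.2].

Lemma spectral_list_exists x : exists L, spectral_list x L.
Proof.
have [s [l [us _ cc c1 xE]]] := spectral_idempotents x.
set c := (fun a => jpoly x (l a)) in cc c1 xE.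
(* Stated for the sums over [s], without [jone] and [x], the claim can be proved by induction on
   [s], each spectral idempotent being split into primitive ones. *)
suff [L [oL L1 Lx]] : exists L, [/\ orth_primitives (map snd L),
    \sum_(u <- L) u.2 = \sum_(a <- s) c a
    & \sum_(a <- s) a *: c a = \sum_(u <- L) u.1 *: u.2].
  by exists L; split; rewrite ?L1 // -Lx.
elim: s us cc {c1 xE} => [_ _|a s IH /= /andP[nas us] cc].
  by exists [::]; rewrite !big_nil.
have [|L [oL L1 Lx]] := IH us.
  by move=> b d bs ds; apply: cc; rewrite inE ?bs ?ds orbT.
have ica : jidempotent (c a).
  by rewrite /jidempotent cc ?eqxx // inE eqxx.
have [t ot tE] := idempotent_primitives ica.
exists ([seq (a, y) | y <- t] ++ L); split.
- rewrite map_cat -map_comp map_id_in //; apply: orth_primitives_cat => //.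
  rewrite tE big_map L1 linear_sum big1_seq // => b /andP[_ bs] /=.
  rewrite cc ?inE ?eqxx ?bs ?orbT //.
  by case: eqVneq bs nas => // -> ->.
- by rewrite big_cat big_cons L1 big_map -tE.
- by rewrite big_cat big_cons Lx big_map -tE scaler_sumr.
Qed.

Lemma jpoly_spectral_list x L p : spectral_list x L ->
  jpoly x p = \sum_(u <- L) p.[u.1] *: u.2.
Proof.
move=> [oL L1 xE]; rewrite /jpoly -L1 linear_sum; apply: eq_big_seq => u uL /=.
apply: pact_eigen => /=; rewrite xE.
move: uL oL; clear; elim: L => // v L IH; rewrite inE big_cons jmulDl jmulZl.
case/orP=> [/eqP->|uL] [prim /= /andP[/allP vL pL]].
  have [-> _ _] : primitive_idempotent v.2 by apply: prim; rewrite inE eqxx.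
  rewrite jmul_suml big1_seq ?addr0 // => z /andP[_ zL].
  have /eqP : jorth v.2 z.2 by apply: vL; apply: map_f.
  by rewrite jmulZl jmulC => ->; rewrite scaler0.
have /eqP -> : jorth v.2 u.2 by apply: vL; apply: map_f.
rewrite scaler0 add0r; apply: IH => //; split=> // z zL.
by apply: prim; rewrite inE zL orbT.
Qed.

Lemma jordan_frame_list n (e : 'I_n -> V) : jordan_frame e ->
  orth_primitives (map e (enum 'I_n)).
Proof.
move=> [prim orth _]; split; first by move=> x /mapP[i _ ->].
rewrite pairwise_map; have := enum_uniq 'I_n; rewrite uniq_pairwise.
by apply: sub_pairwise => i j ij; apply/eqP; exact: orth.
Qed.

Lemma list_jordan_frame n s : size s = n -> orth_primitives s ->
  \sum_(y <- s) y = jone -> jordan_frame (fun i : 'I_n => s`_i).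
Proof.
move=> sn [prim /(pairwiseP 0) pw] s1; subst n.
have h (k m : 'I_(size s)) : (k < m)%N -> s`_k ** s`_m = 0.
  by move=> km; apply/eqP; apply: pw => //; exact: ltn_ord.
split.
- by move=> i; apply/prim/mem_nth.
- move=> i j; rewrite -val_eqE neq_ltn => /orP[|/h]; first exact: h.
  by rewrite jmulC.
- by rewrite -[RHS]s1 (big_nth 0) big_mkord.
Qed.

Variable (n : nat).
Hypothesis V_rank : eja_rank V n.

Lemma orth_primitives_size s : orth_primitives s -> \sum_(y <- s) y = jone ->
  size s = n.
Proof.
case: V_rank => _ h os s1; apply: h.
exact: (list_jordan_frame erefl os s1).
Qed.

(* If the two lists had different multiplicities at [a], exchanging their parts
   at [a], which have the same sum, would give a Jordan frame of wrong size. *)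
Lemma spectral_list_unique x L M : spectral_list x L -> spectral_list x M ->
  perm_eq (map fst L) (map fst M).
Proof.
move=> hL hM; rewrite /perm_eq; apply/allP => a _ /=; apply/eqP.
(* [p] is 1 at [a] and 0 at the other eigenvalues from both lists, so [jpoly x p] is the sum of the
   idempotents at [a] in either list. *)
pose p := lagr (map fst L ++ map fst M) a.
have part N : {subset map fst N <= map fst L ++ map fst M} -> spectral_list x N ->
    jpoly x p = \sum_(u <- N | u.1 == a) u.2.
  move=> sub hN; rewrite (jpoly_spectral_list p hN) [RHS]big_mkcond /=.
  apply: eq_big_seq => u uN; rewrite horner_lagr ?sub ?map_f //.
  by case: eqP; rewrite ?scale1r ?scale0r.
have [oL L1 _] := hL; have [oM M1 _] := hM.
have pL : jpoly x p = \sum_(u <- L | u.1 == a) u.2.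
  by apply: part => // b bL; rewrite mem_cat bL.
have pM : jpoly x p = \sum_(u <- M | u.1 == a) u.2.
  by apply: part => // b bM; rewrite mem_cat bM orbT.
have sub (Q : pred (R * V)) N : orth_primitives (map snd N) ->
    orth_primitives (map snd (filter Q N)).
  move=> [prim pw]; split.
    by move=> y /mapP[u]; rewrite mem_filter => /andP[_ uN] ->; apply/prim/map_f.
  by move: pw; rewrite !pairwise_map; exact: pairwise_filter.
pose F := [seq u <- L | u.1 != a]; pose G := [seq u <- M | u.1 == a].
have sG : \sum_(y <- map snd G) y = jpoly x p.
  by rewrite big_map big_filter pM.
have sF : \sum_(y <- map snd F) y = jone - jpoly x p.
  rewrite big_map big_filter pL -L1 [X in X - _](bigID (fun u => u.1 == a)) /=.
  by rewrite addrAC subrr add0r.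
have := orth_primitives_size (orth_primitives_cat (sub _ _ oL) (sub _ _ oM) _).
move=> /(_ (fun u => u.1 != a) (fun u => u.1 == a)); rewrite -/F -/G sF sG.
have ic := orth_primitives_idem (sub (fun u => u.1 == a) _ oM).
rewrite -/G sG in ic.
rewrite jmulDl jmul1x jmulNl ic subrr => /(_ erefl).
rewrite big_cat /= sF sG subrK => /(_ erefl).
have := orth_primitives_size oL; rewrite big_map => /(_ L1).
rewrite size_cat !size_map !size_filter -(count_predC (fun u => u.1 == a) L).
move=> <- /eqP; rewrite addnC eqn_add2r => /eqP h.
rewrite !count_map; exact: esym h.
Qed.

End SpectralLists.

Section SpectralCones.
Context (R : realType) (V : euclideanJordanType R) (n : nat).
Hypothesis V_rank : eja_rank V n.
Implicit Types (x y : V) (q r : 'cV[R]_n).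

Lemma frame_spectral_list (e : 'I_n -> V) q : jordan_frame e ->
  spectral_list (\sum_i q i 0 *: e i) [seq (q i 0, e i) | i <- enum 'I_n].
Proof.
move=> fe; split; first by rewrite -map_comp; exact: jordan_frame_list fe.
  by rewrite big_map big_enum; case: fe.
by rewrite big_map big_enum.
Qed.

Lemma spectral_decomposition x : exists (e : 'I_n -> V) q,
  [/\ jordan_frame e, x = \sum_i q i 0 *: e i
    & forall i j : 'I_n, (i <= j)%N -> q j 0 <= q i 0].
Proof.
have [L [oL sL xL]] := spectral_list_exists x.
have szL : size L = n.
  by rewrite -(orth_primitives_size V_rank oL) ?size_map // big_map.
have fe : jordan_frame (fun i : 'I_n => (map snd L)`_i).
  by apply: list_jordan_frame; rewrite ?size_map ?big_map.
pose t := [tuple (map fst L)`_i | i < n].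
have [s st] : exists s : 'S_n, sort >=%R t = [tuple tnth t (s i) | i < n].
  by apply/tuple_permP; rewrite perm_sort.
have srt : sorted >=%R (sort >=%R t) by apply: sort_sorted => u v; exact: le_total.
exists (fun i => (map snd L)`_(s i)), (\col_i (map fst L)`_(s i)); split.
- case: fe => prim orth s1; split=> // [i j ij|].
    by apply: orth; apply: contra ij => /eqP/perm_inj ->.
  by rewrite -[RHS]s1 [RHS](reindex_inj (@perm_inj _ s)).
- rewrite [LHS]xL (big_nth 0) big_mkord szL (reindex_inj (@perm_inj _ s)).
  by apply: eq_bigr => i _; rewrite mxE !(nth_map 0) ?szL.
- move=> i j ij; rewrite !mxE.
  have tE (k : 'I_n) : (map fst L)`_(s k) = (sort >=%R t)`_k.
    by rewrite st -(tnth_nth 0 [tuple tnth t (s i) | i < n] k) !tnth_mktuple.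
  rewrite !tE.
  have tr : transitive (>=%R : rel R) by move=> u v w h1 h2; exact: le_trans h2 h1.
  have rf : reflexive (>=%R : rel R) by move=> u; exact: lexx.
  apply: (sorted_leq_nth tr rf 0 srt) => //.
    by rewrite inE size_sort size_tuple.
  by rewrite inE size_sort size_tuple.
Qed.

(** Membership may be tested on any frame with the eigenvalues in any order: by uniqueness they are
    a permutation of the ordered ones, and [Q] is permutation invariant. *)
Lemma spectral_cone_frame (K : set V) : spectral_cone n K ->
  exists Q : set 'cV[R]_n,
    (forall (s : 'S_n) q, Q q -> Q (perm_mx s *m q)) /\
    forall (e : 'I_n -> V) q, jordan_frame e ->
      K (\sum_i q i 0 *: e i) <-> Q q.
Proof.
move=> [Q [[_ Qs] _ ->]]; have {}Qs (s : 'S_n) q : Q q -> Q (perm_mx s *m q).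
  by move=> Qq; rewrite -(Qs s); exists q.
exists Q; split=> // e q fe; set x := \sum_i _.
have [f [r0 [ff xr0 srt]]] := spectral_decomposition x.
(* The set contains [r0], so [xget] does not return its default. *)
have : @eigenvalue_vectors _ V n x (eigenvalue_map n x).
  by apply: (@xgetI _ _ _ r0); split=> //; exists f.
rewrite /preimage /=; move: (eigenvalue_map n x) => r [_ [g gf xr]].
have := frame_spectral_list r gf; rewrite -xr => hr.
have /tuple_permP[s st] : perm_eq [tuple r i 0 | i < n] [tuple q i 0 | i < n].
  have h := spectral_list_unique V_rank hr (frame_spectral_list q fe).
  have tE (u : 'cV[R]_n) (b : 'I_n -> V) : tval [tuple u i 0 | i < n] =
      map fst [seq (u i 0, b i) | i <- enum 'I_n] by rewrite -[RHS]map_comp.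
  by rewrite (tE r g) (tE q e).
have rE : r = perm_mx s *m q.
  rewrite -row_permE; apply/matrixP => i j; rewrite mxE ord1.
  have /(congr1 (fun t => tnth t i)) := val_inj st.
  by rewrite !tnth_mktuple.
rewrite rE; split=> [/(Qs s^-1%g)|/Qs//].
by rewrite mulmxA -perm_mxM mulVg perm_mx1 mul1mx.
Qed.

End SpectralCones.

(** * Reflections *)

Section Reflections.
Context (R : realType) (V : euclideanJordanType R).
Implicit Types (c w x y z : V).

Fact jrefl_linear w : linear (jrefl w).
Proof. by move=> a x y; rewrite /jrefl; jlin. Qed.

HB.instance Definition _ w :=
  GRing.isLinear.Build R V V *:%R (jrefl w) (jrefl_linear w).

Lemma jrefl1 w : w ** w = jone -> jrefl w jone = jone.
Proof. by move=> ww; rewrite /jrefl jmulx1 ww; jlin. Qed.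

Lemma jrefl_eq0 w x : w ** w = jone -> (jrefl w x == 0) = (x == 0).
Proof.
move=> ww; apply/eqP/eqP => [h|->]; last exact: linear0.
by rewrite -(jreflK ww x) h linear0.
Qed.

Lemma jrefl_primitive w c : w ** w = jone ->
  primitive_idempotent c -> primitive_idempotent (jrefl w c).
Proof.
move=> ww [ic c0 pc]; split; [|by rewrite jrefl_eq0|].
  by rewrite /jidempotent -jreflM // ic.
move=> [c1 [c2 [i1 i2 n1 n2 e]]]; apply: pc.
exists (jrefl w c1), (jrefl w c2); split; rewrite ?jrefl_eq0 //.
- by rewrite /jidempotent -jreflM // i1.
- by rewrite /jidempotent -jreflM // i2.
- by rewrite -linearD -e /= jreflK.
Qed.

Lemma jrefl_frame w n (e : 'I_n -> V) : w ** w = jone ->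
  jordan_frame e -> jordan_frame (jrefl w \o e).
Proof.
move=> ww [prim orth s1]; split.
- by move=> i; exact: jrefl_primitive.
- by move=> i j ij; rewrite /= -jreflM // orth // linear0.
- by rewrite -linear_sum s1 /= jrefl1.
Qed.

Lemma jrefl_jpoly w x p : w ** w = jone ->
  jrefl w (jpoly x p) = jpoly (jrefl w x) p.
Proof.
move=> ww; rewrite /jpoly; elim/poly_ind: p => [|p d IH].
  by rewrite !pact0 linear0.
rewrite !pactD !pactMX !pactC -IH linearD linearZ /= jrefl1 //.
by rewrite jreflM.
Qed.

(* A nonzero [x] with [w x = 0] has the reflection of a spectral idempotent for
   the eigenvalue [a] as a spectral idempotent for [-a]; the tripotent is the
   difference of the two. *)
Lemma odd_tripotent w x : w ** w = jone -> w ** x = 0 -> x != 0 ->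
  exists v, [/\ v != 0, w ** v = 0 & (v ** v) ** v = v].
Proof.
move=> ww wx x0; have Sx : jrefl w x = - x by rewrite /jrefl wx jmul0r; jlin.
have jcomm z p y : jpoly z p ** (z ** y) = z ** (jpoly z p ** y).
  rewrite /jpoly /pact !jmul_suml linear_sum; apply: eq_bigr => i _.
  by rewrite !jmulZl jpow_comm /= jmulZr.
have [s [l [_ xc cc _ xE]]] := spectral_idempotents x.
have [a [ain a0 p0]] : exists a, [/\ a \in s, a != 0 & jpoly x (l a) != 0].
  apply: contrapT => h; move/eqP: x0; apply; rewrite xE big1_seq // => a /= ain.
  apply/eqP; rewrite scaler_eq0; apply: contrapT => /negP.
  by rewrite negb_or => /andP[a0 p0]; apply: h; exists a.
have pp := cc a a ain ain; rewrite eqxx in pp; have xp := xc a ain.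
set p := jpoly x (l a) in p0 pp xp; set y := jrefl w p.
have yE : y = jpoly (- x) (l a).
  by rewrite /y jrefl_jpoly // Sx.
have yy : y ** y = y by rewrite /y -jreflM // pp.
have xy : x ** y = - a *: y.
  have := jreflM ww x p; rewrite xp linearZ /= Sx -/y jmulNl => h.
  by jlin_from h.
(* As [p] is a polynomial in [x], [x (p y) = p (x y) = - a (p y)]; as [y] is one in [- x], also
   [x (p y) = y (x p) = a (p y)]. *)
have py : p ** y = 0.
  have h1 := jcomm x (l a) y; rewrite -/p xy jmulZr in h1.
  have h2 := jcomm (- x) (l a) p; rewrite -yE !jmulNl xp jmulNr jmulZr in h2.
  rewrite (jmulC y p) -h1 in h2.
  apply/eqP; have /eqP : (2%:R * a) *: (p ** y) = 0 by jlin_from h2.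
  by rewrite scaler_eq0 mulf_eq0 pnatr_eq0 (negPf a0).
have yp : y ** p = 0 by rewrite jmulC.
exists (p - y); split.
- apply: contra a0 => /eqP /subr0_eq e; have : x ** p = x ** y by rewrite -e.
  rewrite xp xy -e => h; have /eqP : (2%:R * a) *: p = 0 by jlin_from h.
  by rewrite scaler_eq0 mulf_eq0 pnatr_eq0 (negPf p0) orbF.
- have : jrefl w (p - y) = - (p - y).
    by rewrite linearB /= -/y /y jreflK // opprB.
  rewrite /jrefl => h; have h' : w ** (w ** (p - y)) = 0.
    by move: (p - y) h => u h; jlin_from h.
  by rewrite -(inv_jmul3 ww) h' jmul0r.
- clearbody y p; have -> : (p - y) ** (p - y) = p + y.
    by rewrite !(jmulDl, jmulDr, jmulNl, jmulNr) pp py yp yy; jlin.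
  by rewrite !(jmulDl, jmulDr, jmulNl, jmulNr) pp py yp yy; jlin.
Qed.

End Reflections.

Section SpectralConeSymmetries.
Context (R : realType) (V : euclideanJordanType R) (n : nat) (K : set V).
Hypotheses (V_rank : eja_rank V n) (K_spectral : spectral_cone n K).
Implicit Types (w x y : V).

(** A reflection maps Jordan frames to Jordan frames and so keeps the eigenvalues. *)
Lemma spectral_cone_jrefl w x : w ** w = jone -> K x -> K (jrefl w x).
Proof.
move=> ww; have [Q [_ QK]] := spectral_cone_frame V_rank K_spectral.
have [e [q [fe -> _]]] := spectral_decomposition V_rank x.
move=> /(QK e q fe) Qq; rewrite linear_sum.
have -> : \sum_i jrefl w (q i 0 *: e i) = \sum_i q i 0 *: (jrefl w \o e) i.
  by apply: eq_bigr => i _; rewrite linearZ.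
by apply/(QK _ _ (jrefl_frame ww fe)).
Qed.

(* [y] is the sum of the other permutations of the eigenvalues of [x]. *)
Lemma spectral_cone_trace x : convex_cone K -> K x ->
  exists y s, K y /\ x + y = s *: jone.
Proof.
move=> cK; have [Q [Qs QK]] := spectral_cone_frame V_rank K_spectral.
have [e [q [fe xE _]]] := spectral_decomposition V_rank x.
rewrite {1}xE => /(QK e q fe) Qq.
pose xs (s : 'S_n) := \sum_i q (s i) 0 *: e i.
have Kxs s : K (xs s).
  have /(QK _ _ fe) := Qs s q Qq; congr (K _); apply: eq_bigr => i _.
  by rewrite -row_permE mxE.
pose t i := \sum_(s : 'S_n) q (s i) 0.
(* Composing with the transposition of [i] and [j] permutes the summands. *)
have tE i j : t i = t j.
  rewrite /t (reindex_inj (mulgI (tperm i j))); apply: eq_bigr => s _.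
  by rewrite permM tpermL.
(* The scalar is the common value of [t]; its default [0] is for [n = 0], where there is no
   index. *)
exists (\sum_(s : 'S_n | s != (1%g : 'S_n)) xs s),
  (if [pick i : 'I_n] is Some i then t i else 0).
split; first exact: cone_sum.
have -> : x = xs (1%g : 'S_n) by rewrite xE; apply: eq_bigr => i _; rewrite perm1.
have <- : \sum_s xs s = xs (1%g : 'S_n) + \sum_(s : 'S_n | s != (1%g : 'S_n)) xs s.
  by rewrite (bigD1 (1%g : 'S_n)).
rewrite /xs exchange_big /=; case: fe => _ _ <-.
rewrite scaler_sumr; apply: eq_bigr => i _; rewrite -scaler_suml; congr (_ *: _).
by case: pickP => [j _|/(_ i)//]; exact: tE.
Qed.

End SpectralConeSymmetries.

(** * Simple algebras *)

Section IdealAlgebra.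
Context (R : realType) (V : euclideanJordanType R) (U : {vspace V}) (u : V).
Hypothesis uU : u \in U.
Hypothesis U_mul : forall x y, x \in U -> y \in U -> x ** y \in U.
Hypothesis U_one : forall x, x \in U -> u ** x = x.

Let smul (x y : subvs_of U) : subvs_of U := vsproj U (vsval x ** vsval y).
Let sone : subvs_of U := vsproj U u.
Let sinner (x y : subvs_of U) : R := inner (vsval x) (vsval y).

Let val_smul x y : vsval (smul x y) = vsval x ** vsval y.
Proof. by rewrite vsprojK // U_mul ?subvsP. Qed.

Let smulC : commutative smul.
Proof. by move=> x y; rewrite /smul jmulC. Qed.

Let smulPl (a : R) x y z : smul (a *: x + y) z = a *: smul x z + smul y z.
Proof. by apply: subvs_inj; rewrite linearP /= !val_smul linearP /= jmulPl. Qed.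

Let smul1x : left_id sone smul.
Proof. by move=> x; apply: subvs_inj; rewrite val_smul vsprojK // U_one ?subvsP. Qed.

Let sjordan x y : smul x (smul (smul x x) y) = smul (smul x x) (smul x y).
Proof. by apply: subvs_inj; rewrite !val_smul jordan_identity. Qed.

Let sinnerC x y : sinner x y = sinner y x.
Proof. exact: innerC. Qed.

Let sinnerPl (a : R) x y z :
  sinner (a *: x + y) z = a * sinner x z + sinner y z.
Proof. by rewrite /sinner linearP innerPl. Qed.

Let sinner_gt0 x : x != 0 -> 0 < sinner x x.
Proof.
move=> x0; apply: inner_gt0; apply: contra x0 => /eqP h.
by apply/eqP/subvs_inj; rewrite h linear0.
Qed.

Let sinner_jmul x y z : sinner (smul x y) z = sinner y (smul x z).
Proof. by rewrite /sinner !val_smul inner_jmul. Qed.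

(** The unit is [u] and not [jone]: [U] will be the Peirce space 1 or 0 of an idempotent [c], and
    [u] will be [c] or [jone - c]. *)
Definition ideal_algebra : euclideanJordanType R :=
  HB.pack (subvs_of U) (isEuclideanJordan.Build R (subvs_of U)
    smulC smulPl smul1x sjordan sinnerC sinnerPl sinner_gt0 sinner_jmul).

Lemma ideal_algebra_jmul (x y : ideal_algebra) :
  jmul x y = vsproj U (vsval (x : subvs_of U) ** vsval (y : subvs_of U)).
Proof. by []. Qed.

Lemma ideal_algebra_inner (x y : ideal_algebra) :
  inner x y = inner (vsval (x : subvs_of U)) (vsval (y : subvs_of U)).
Proof. by []. Qed.

End IdealAlgebra.

(** Without a Peirce space 1/2, the algebra is the direct product of the Peirce spaces 1 and 0 of
    [c], with units [c] and [jone - c]. *)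
Lemma simple_idempotent (R : realType) (V : euclideanJordanType R) (c : V) :
  eja_simple V -> jidempotent c -> (forall x, c ** x = 2^-1 *: x -> x = 0) ->
  c = 0 \/ c = jone.
Proof.
move=> [_ simple] ic half; have [c0|c0] := eqVneq c 0; first by left.
have [c1|c1] := eqVneq c jone; first by right.
exfalso; apply: simple; have cc : c ** c = c := ic.
(* The odd part [x - w (w x)] lies in the Peirce space 1/2, hence is 0. *)
have ccx x : c ** (c ** x) = c ** x.
  pose w := 2%:R *: c - jone; have ww := idem_inv ic.
  have := inv_jmul3 ww x; rewrite -/w => h.
  have /(odd_half c) /half h0 : w ** (x - w ** (w ** x)) = 0.
    by rewrite jmulDr jmulNr h subrr.
  move: h0; rewrite /w !(jmulDl, jmulDr, jmulZl, jmulZr, jmulNl, jmulNr).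
  by rewrite jmul1x => h0; jlin_from h0.
have lin0 : linear (fun x : V => x - c ** x).
  by move=> a x y; rewrite jmulDr jmulZr; jlin.
pose L0 : {linear V -> V} := HB.pack (fun x : V => x - c ** x)
  (GRing.isLinear.Build R V V *:%R _ lin0).
pose U1 := lker (linfun L0); pose U0 := lker (linfun (jmul c)).
have U1E x : x \in U1 <-> c ** x = x.
  by rewrite memv_ker lfunE /= subr_eq0; split=> [/eqP|->].
have U0E x : x \in U0 <-> c ** x = 0 by rewrite memv_ker lfunE /=; split=> [/eqP|->].
have cU x : c ** x \in U1 by apply/U1E.
have dU x : x - c ** x \in U0 by apply/U0E; rewrite jmulDr jmulNr ccx subrr.
have u1 : c \in U1 by apply/U1E.
have u0 : jone - c \in U0 by apply/U0E; rewrite jmulDr jmulNr jmulx1 cc subrr.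
have m1 x y : x \in U1 -> y \in U1 -> x ** y \in U1.
  by move=> /U1E hx /U1E hy; apply/U1E; exact: peirce11.
have m0 x y : x \in U0 -> y \in U0 -> x ** y \in U0.
  by move=> /U0E hx /U0E hy; apply/U0E; exact: peirce00.
have e1 x : x \in U1 -> c ** x = x by move/U1E.
have e0 x : x \in U0 -> (jone - c) ** x = x.
  by move=> /U0E h; rewrite jmulDl jmulNl jmul1x h subr0.
pose V1 := ideal_algebra u1 m1 e1; pose V0 := ideal_algebra u0 m0 e0.
exists V1, V0; split.
- exists (vsproj U1 c : V1); apply: contra c0 => /eqP h; apply/eqP.
  by rewrite -(vsprojK u1) (h : vsproj U1 c = 0) linear0.
- exists (vsproj U0 (jone - c) : V0); apply: contra c1 => /eqP h.
  apply/eqP/esym/subr0_eq.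
  by rewrite -(vsprojK u0) (h : vsproj U0 (jone - c) = 0) linear0.
pose f (x : V) : (V1 * V0)%type := (vsproj U1 (c ** x), vsproj U0 (x - c ** x)).
have flin : linear f.
  move=> a x y; congr (_, _).
    by rewrite jmulDr jmulZr; exact: (linearP (vsproj U1)).
  by rewrite (lin0 a x y); exact: (linearP (vsproj U0)).
pose F : {linear V -> (V1 * V0)%type} := HB.pack f
  (GRing.isLinear.Build R V (V1 * V0)%type *:%R f flin).
have orth (x y : V) : inner (c ** x) (y - c ** y) = 0.
  rewrite inner_jmul jmulDr jmulNr ccx subrr innerC inner0l //.
have dE (x : V) : x = c ** x + (x - c ** x) by rewrite addrC subrK.
have pE (x y : V) : (c ** x + (x - c ** x)) ** (c ** y + (y - c ** y)) =
    (c ** x) ** (c ** y) + (x - c ** x) ** (y - c ** y).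
  have h1 := peirce10 ic (ccx x) (iffLR (U0E _) (dU y)).
  have h0 := peirce10 ic (ccx y) (iffLR (U0E _) (dU x)).
  rewrite !(jmulDl (c ** x)) !(jmulDr _ (c ** y)) h1 addr0.
  by rewrite (jmulC (x - c ** x) (c ** y)) h0 add0r.
have xyE (x y : V) : x ** y = (c ** x) ** (c ** y) + (x - c ** x) ** (y - c ** y).
  by rewrite -pE -!dE.
have cxyE (x y : V) : c ** (x ** y) = (c ** x) ** (c ** y).
  rewrite (xyE x y) jmulDr (e1 _ (m1 _ _ (cU x) (cU y))).
  have cz : c ** ((x - c ** x) ** (y - c ** y)) = 0.
    by apply/U0E; exact: (m0 _ _ (dU x) (dU y)).
  by rewrite cz addr0.
have dxyE (x y : V) : x ** y - c ** (x ** y) = (x - c ** x) ** (y - c ** y).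
  by rewrite cxyE (xyE x y) addrAC subrr add0r.
exists F; split.
- exists (fun p : (V1 * V0)%type =>
    vsval (p.1 : subvs_of U1) + vsval (p.2 : subvs_of U0)).
    by move=> x; rewrite /= !vsprojK // addrC subrK.
  move=> [x y] /=; have /U1E hx := subvsP (x : subvs_of U1).
  have /U0E hy := subvsP (y : subvs_of U0).
  rewrite /f jmulDr hx hy addr0 addrAC subrr add0r.
  by congr (_, _); exact: vsvalK.
- move=> x y; rewrite /= /f; congr (_, _).
    by rewrite ideal_algebra_jmul !vsprojK // cxyE.
  by rewrite ideal_algebra_jmul !vsprojK // dxyE.
- move=> x y.
  transitivity (inner (c ** x) (c ** y) + inner (x - c ** x) (y - c ** y)).
    by congr (_ + _); rewrite ideal_algebra_inner /= !vsprojK.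
  have o1 := orth x y; have o2 := orth y x.
  rewrite innerC innerDl innerNl in o1; rewrite innerC innerDl innerNl in o2.
  rewrite (innerC x (c ** y)) (innerC (c ** x) (c ** y)) in o2.
  rewrite innerDl innerNl !(innerC _ (y - c ** y)) !innerDl !innerNl.
  rewrite (innerC x y) (innerC (c ** x) (c ** y)); lra.
Qed.

Lemma poly_nonroot (R : realType) (p : {poly R}) : p != 0 -> exists t, p.[t] != 0.
Proof.
move=> p0; apply: contrapT => h; move/eqP: p0; apply.
apply: (roots_geq_poly_eq0 (rs := [seq i%:R | i <- iota 0 (size p)])).
- apply/allP => t _; apply/rootP/eqP; apply: contrapT => /negP ht.
  by apply: h; exists t.
- by rewrite map_inj_uniq ?iota_uniq //; exact: mulrIn (oner_neq0 R).
- by rewrite size_map size_iota.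
Qed.

Section PolynomialFamily.
Import VectorInternalTheory.

(** The polynomial is the determinant of the family as a function of [t]; it is nonzero because its
    value at 0 is the determinant of the identity. *)
Lemma poly_family_inj (R : realType) (V : vectType R) (d : nat)
    (A : nat -> V -> V) : (forall k, linear (A k)) -> A 0%N =1 id ->
  exists2 p : {poly R}, p != 0 & forall t x, p.[t] != 0 ->
    \sum_(k < d.+1) t ^+ k *: A k x = 0 -> x = 0.
Proof.
move=> Alin A0;
pose L k : {linear V -> V} := HB.pack (A k)
  (GRing.isLinear.Build R V V *:%R (A k) (Alin k)).
pose M k : 'M[R]_(dim V) := lin1_mx (v2r \o L k \o r2v).
have ME k x : v2r (A k x) = v2r x *m M k by rewrite mul_rV_lin1 /= v2rK.
pose P : 'M[{poly R}]_(dim V) := \sum_(k < d.+1) 'X^k *: map_mx polyC (M k).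
have PE t : map_mx (horner_eval t) P = \sum_(k < d.+1) t ^+ k *: M k.
  rewrite map_mx_sum; apply: eq_bigr => k _; move: (M k) => N.
  apply/matrixP => i j.
  by rewrite !mxE /= /horner_eval hornerM hornerXn hornerC.
have dE t : (\det P).[t] = \det (\sum_(k < d.+1) t ^+ k *: M k).
  by rewrite -PE det_map_mx.
exists (\det P) => [|t x].
  apply/negP => /eqP /(congr1 (fun p => p.[0])); rewrite dE horner0.
  rewrite big_ord_recl expr0 scale1r big1 ?addr0 => [|k _]; last first.
    by rewrite expr0n /= scale0r.
  have -> : M 0%N = 1%:M.
    have e (u : 'rV[R]_(dim V)) : u *m M 0%N = u by rewrite -{1}(r2vK u) -ME A0 r2vK.
    by rewrite -[LHS]mul1mx; apply/row_matrixP => i; rewrite row_mul e.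
  by rewrite det1 => /eqP; rewrite oner_eq0.
rewrite dE => dn0 /(congr1 v2r); rewrite linear0 linear_sum.
under eq_bigr do rewrite linearZ /= ME scalemxAr.
rewrite -mulmx_sumr => h; apply/(can_inj v2rK); rewrite linear0.
have un : (\sum_(k < d.+1) t ^+ k *: M k) \in unitmx by rewrite unitmxE unitfE.
by rewrite -(mulmxK un (v2r x)) h mul0mx.
Qed.

End PolynomialFamily.

(** * Rotations *)

Section Rotation.
Context (R : realType) (V : euclideanJordanType R).
Implicit Types (c v x : V) (t : R).

(* Scaled by [1 + t^2], so as to be polynomial in [t]. *)
Definition rot_inv (b0 b1 b2 : V) t : V := b0 + t *: b1 + t ^+ 2 *: b2.

(* The rotation by an angle [phi], with [t = tan (phi / 2)], in the plane spanned
   by [h] and [v], where [f = v^2], [h = 2 c f - f] and [g = e - f]: the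
   involution is [cos phi h + sin phi v + g]. *)
Lemma tripotent_rotation c v : jidempotent c -> v != 0 ->
    c ** v = 2^-1 *: v -> (v ** v) ** v = v ->
  exists b0 b1 b2 : V, let w := rot_inv b0 b1 b2 in
    [/\ forall t, w t ** w t = (1 + t ^+ 2) ^+ 2 *: jone,
        jrefl b0 c = c
      & forall t, t != 0 -> t ^+ 2 != 1 ->
          jrefl ((1 + t ^+ 2)^-1 *: w t) c <> c].
Proof.
move=> ic v0 cv fv; have cc : c ** c = c := ic.
set f := v ** v in fv; have ww := idem_inv ic.
have wv : (2%:R *: c - jone) ** v = 0 by apply/odd_half.
have wf := odd_odd ww wv wv; rewrite -/f in wf.
have vf : v ** f = v by rewrite jmulC.
have ff : f ** f = f by rewrite {1}/f -jordan_identity -/f fv.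
have fc y : f ** (c ** y) = c ** (f ** y).
  have := even_jmulA ww y wf; rewrite !(jmulDl, jmulNl, jmulZl) !jmul1x => h.
  by rewrite !(jmulDr, jmulNr, jmulZr) in h; jlin_from h.
have ccf : c ** (c ** f) = c ** f.
  move: wf; rewrite !(jmulDl, jmulDr, jmulNl, jmulNr, jmulZl, jmulZr, jmul1x).
  by move=> h; jlin_from h.
(* From here a multiplication table is built, first for [c], [v], [f], [f1], then with [h] and [g].
   [h] is the difference of the orthogonal idempotents [f1] and [f - f1]. *)
pose f1 := c ** f; have cf1 : c ** f1 = f1 by [].
have f1c : f1 ** c = f1 by rewrite jmulC.
have ff1 : f ** f1 = f1 by rewrite /f1 fc ff.
have f1f : f1 ** f = f1 by rewrite jmulC.
have f1f1 : f1 ** f1 = f1.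
  have wf1 : (2%:R *: c - jone) ** f1 = f1.
    by rewrite jmulDl jmulNl jmulZl cf1 jmul1x; jlin.
  have wwf1 : (2%:R *: c - jone) ** ((2%:R *: c - jone) ** f1) = f1 by rewrite wf1.
  have := even_jmulA ww f wwf1; rewrite !(jmulDl, jmulNl, jmulZl) !jmul1x => h.
  rewrite !(jmulDr, jmulNr, jmulZr) f1f -/f1 cf1 in h.
  by jlin_from h.
have vf1 : v ** f1 = 2^-1 *: v.
  by rewrite /f1 (jmulC c) jordan_identity -/f (jmulC v c) cv jmulZr fv.
have f1v : f1 ** v = 2^-1 *: v by rewrite jmulC.
have fcE : f ** c = f1 by rewrite jmulC.
have vc : v ** c = 2^-1 *: v by rewrite jmulC.
have vv : v ** v = f by [].
clearbody f1 f.
pose h := 2%:R *: f1 - f; pose g := jone - f.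
have gc : g ** c = c - f1 by rewrite /g jmulDl jmulNl jmul1x fcE.
have gf1 : g ** f1 = 0 by rewrite /g jmulDl jmulNl jmul1x ff1 subrr.
have gv : g ** v = 0 by rewrite /g jmulDl jmulNl jmul1x fv subrr.
have gf : g ** f = 0 by rewrite /g jmulDl jmulNl jmul1x ff subrr.
have gg : g ** g = g by rewrite {2}/g jmulDr jmulNr jmulx1 gf subr0.
have hc : h ** c = f1 by rewrite /h jmulDl jmulNl jmulZl f1c fcE; jlin.
have hf1 : h ** f1 = f1 by rewrite /h jmulDl jmulNl jmulZl f1f1 ff1; jlin.
have hv : h ** v = 0 by rewrite /h jmulDl jmulNl jmulZl f1v fv; jlin.
have hf : h ** f = h by rewrite /h jmulDl jmulNl jmulZl f1f ff.
have hh : h ** h = f by rewrite {2}/h jmulDr jmulNr jmulZr hf1 hf /h; jlin.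
have hg : h ** g = 0 by rewrite /g jmulDr jmulNr jmulx1 hf subrr.
have gh : g ** h = 0 by rewrite jmulC.
have vg : v ** g = 0 by rewrite jmulC.
have vh : v ** h = 0 by rewrite jmulC.
have fE : f = 2%:R *: f1 - h by rewrite /h; jlin.
have gE : g = jone - f by [].
clearbody h g.
(* The coefficients of 1, [t] and [t^2] in [(1 - t^2) h + 2 t v + (1 + t^2) g]. *)
exists (h + g), (2%:R *: v), (g - h) => w.
have wE t : w t = (1 - t ^+ 2) *: h + (2%:R * t) *: v + (1 + t ^+ 2) *: g.
  by rewrite /w /rot_inv; jlin.
have wc t : w t ** c = (1 - t ^+ 2) *: f1 + t *: v + (1 + t ^+ 2) *: (c - f1).
  by rewrite wE !(jmulDl, jmulZl) hc vc gc; jlin.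
have wf1 t : w t ** f1 = (1 - t ^+ 2) *: f1 + t *: v.
  by rewrite wE !(jmulDl, jmulZl) hf1 vf1 gf1; jlin.
have wtv t : w t ** v = (2%:R * t) *: f.
  by rewrite wE !(jmulDl, jmulZl) hv vv gv; jlin.
have wwc t : 2%:R *: (w t ** (w t ** c)) = ((1 + t ^+ 2) ^+ 2 *+ 2) *: c
    + (2%:R * t * (1 - t ^+ 2)) *: v - (2%:R * t) ^+ 2 *: h.
  rewrite wc !(jmulDr, jmulNr, jmulZr) wc wf1 wtv fE; jlin.
split.
- move=> t; rewrite wE !(jmulDl, jmulDr, jmulZl, jmulZr).
  by rewrite hh hv hg vh vv vg gh gv gg gE; jlin.
- have := wwc 0; have -> : w 0 = h + g by rewrite wE; jlin.
  by rewrite /jrefl => ->; jlin.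
- move=> t t0 t1; rewrite /jrefl !jmulZl jmulZr !scalerA => H.
  set r := 1 + t ^+ 2 in H wwc; have r0 : r != 0.
    by rewrite gt_eqF // ltr_wpDr ?sqr_ge0.
  have {}H : 2%:R *: (w t ** (w t ** c)) = (r ^+ 2 *+ 2) *: c.
    have -> : 2%:R *: (w t ** (w t ** c)) =
        r ^+ 2 *: (c + ((2%:R * r^-1 * r^-1) *: (w t ** (w t ** c)) - c)).
      rewrite addrC subrK scalerA; congr (_ *: _); field.
      exact: r0.
    by rewrite mulrA in H; rewrite H; jlin.
  rewrite wwc in H; have {}H : (2%:R * t * (1 - t ^+ 2)) *: v = (2%:R * t) ^+ 2 *: h.
    by move: (r ^+ 2 *+ 2) (_ * (1 - _)) (_ ^+ 2) H => a b d H; jlin_from H.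
  have t1' : 1 - t ^+ 2 != 0 by rewrite subr_eq0 eq_sym.
  (* Multiplying by [v] kills [h] and turns [v] into [f], so [f = 0], against [f v = v]. *)
  have := congr1 (jmul v) H; rewrite !jmulZr vv vh scaler0 => /eqP.
  rewrite scaler_eq0 !mulf_eq0 pnatr_eq0 (negPf t0) (negPf t1') /=.
  by move=> /eqP f0; move: v0; rewrite -fv f0 jmul0l eqxx.
Qed.

(** With [S_t] the reflection at the normalised [rot_inv b0 b1 b2 t], the operator
    [x - P x + P (S_0 (S_t x))] is the identity at [t = 0], becomes polynomial when multiplied by
    [(1 + t^2)^2], and kills every [x] satisfying the two equations. So [poly_family_inj]
    applies. *)
Lemma rotation_injective (P : {linear V -> V}) (b0 b1 b2 : V) :
    b0 ** b0 = jone ->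
  exists2 p : {poly R}, p != 0 & forall t x, p.[t] != 0 -> P x = x ->
    P (jrefl b0 (jrefl ((1 + t ^+ 2)^-1 *: rot_inv b0 b1 b2 t) x)) = 0 -> x = 0.
Proof.
(* [rho] lists the coefficients of [(1 + t^2)^2], and [B k] is the coefficient of [t^k] in the
   square of multiplication by [rot_inv b0 b1 b2 t]. *)
move=> bb; pose rho k : R := nth 0 [:: 1; 0; 2%:R; 0; 1] k.
pose B k (x : V) : V := match k with
  | 0 => b0 ** (b0 ** x)
  | 1 => b0 ** (b1 ** x) + b1 ** (b0 ** x)
  | 2 => b0 ** (b2 ** x) + b1 ** (b1 ** x) + b2 ** (b0 ** x)
  | 3 => b1 ** (b2 ** x) + b2 ** (b1 ** x)
  | 4 => b2 ** (b2 ** x)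
  | _ => 0 end.
pose G k (x : V) := 2%:R *: B k x - rho k *: x.
have Glin k : linear (G k).
  by move=> a x y; rewrite /G /B; case: k => [|[|[|[|[|k]]]]]; jlin.
pose A k (x : V) := rho k *: (x - P x) + P (jrefl b0 (G k x)).
have Alin k : linear (A k).
  by move=> a x y; rewrite /A Glin !linearP /=; jlin.
have A0 : A 0%N =1 id.
  move=> x; rewrite /A /G /B /rho /= scale1r scale1r -/(jrefl b0 x).
  by rewrite jreflK // subrK.
have [p p0 hp] := poly_family_inj 4 Alin A0.
exists p => // t x pt Px PS; apply: (hp t x pt).
pose r := 1 + t ^+ 2; have r0 : r != 0 by rewrite gt_eqF // ltr_wpDr ?sqr_ge0.
set S := jrefl _ x in PS.
have GS : \sum_(k < 5) t ^+ k *: G k x = r ^+ 2 *: S.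
  have -> : r ^+ 2 *: S = 2%:R *: (rot_inv b0 b1 b2 t ** (rot_inv b0 b1 b2 t ** x))
      - r ^+ 2 *: x.
    rewrite /S /jrefl !(jmulZl, jmulZr) scalerBr !scalerA; congr (_ *: _ - _).
    by rewrite -/r; field.
  rewrite !big_ord_recl big_ord0 /= /G /rho /= /bump /= /r /rot_inv; jlin.
transitivity (\sum_(k < 5) P (jrefl b0 (t ^+ k *: G k x))).
  by apply: eq_bigr => k _; rewrite /A Px subrr scaler0 add0r !linearZ.
by rewrite -!linear_sum GS !linearZ /= PS scaler0.
Qed.

End Rotation.

(** * Decompositions of spectral cones *)

(** A finite subset of [K] whose span has maximal dimension already spans [K]. *)
Lemma span_set_vspace (R : realType) (E : vectType R) (K : set E) :
  exists U : {vspace E}, forall x, span_set K x <-> x \in U.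
Proof.
pose P d := `[< exists2 s : seq E, {in s, forall y, K y} & \dim <<s>> = d >].
have P0 : exists d, P d.
  by exists (\dim <<[::] : seq E>>); apply/asboolP; exists [::].
have Pb d : P d -> (d <= \dim {: E})%N.
  by move=> /asboolP[s _ <-]; exact/dimvS/subvf.
case: (ex_maxnP P0 Pb) => d /asboolP[s sK sd] max.
exists <<s>>%VS => x; split; last by move=> xs; exists s.
move=> [r rK]; apply/subvP; have sub : (<<s>> <= <<s ++ r>>)%VS.
  by rewrite span_cat addvSl.
have -> : <<s>>%VS = <<s ++ r>>%VS.
  apply/eqP; rewrite -(dimv_leqif_eq sub) eqn_leq dimvS //= sd; apply: max.
  apply/asboolP; exists (s ++ r) => // y; rewrite mem_cat => /orP[]; last exact: rK.
  exact: sK.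
by rewrite span_cat addvSr.
Qed.

Section DecomposedCone.
Context (R : realType) (V : euclideanJordanType R) (n : nat) (K : set V).
Hypotheses (V_rank : eja_rank V n) (K_spectral : spectral_cone n K).
Hypothesis K_pointed : pointed_cone K.
Implicit Types (P : {linear V -> V}) (w x y : V).

(** A decomposition of [K] is used only through its projection; exchanging the two summands replaces
    [P x] by [x - P x]. *)
Definition cone_projection P : Prop :=
  [/\ forall x, P (P x) = P x, forall x, K x -> K (P x)
    & forall x, K x -> K (x - P x)].

Lemma cone_projection_compl P : cone_projection P ->
  exists2 N : {linear V -> V}, (forall x, N x = x - P x) & cone_projection N.
Proof.
move=> [PP PK NK]; have lin : linear (fun x => x - P x).
  by move=> a x y; rewrite linearP; jlin.
pose N : {linear V -> V} := HB.pack (fun x => x - P x)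
  (GRing.isLinear.Build R V V *:%R _ lin).
exists N; first by [].
split=> x /=.
- by rewrite linearB /= PP subrr subr0.
- exact: NK.
- by rewrite subKr; exact: PK.
Qed.

Let cK : convex_cone K := proj1 K_pointed.

(* [b' = w w0 b] splits as [P b' + (b' - P b')]; going back, the two parts sum to
   [b], so by pointedness [P] kills each of them. *)
Lemma cone_projection_transport P w0 w b : cone_projection P ->
    w0 ** w0 = jone -> w ** w = jone ->
    (forall x, P x = x -> P (jrefl w0 (jrefl w x)) = 0 -> x = 0) ->
  K b -> P b = 0 -> P (jrefl w (jrefl w0 b)) = 0.
Proof.
move=> [PP PK NK] ww0 ww inj Kb Pb; set b' := jrefl w (jrefl w0 b).
have KS v x : v ** v = jone -> K x -> K (jrefl v x).
  by move=> vv; exact: (spectral_cone_jrefl V_rank K_spectral vv).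
have Kb' : K b' by apply: (KS _ _ ww); exact: KS.
apply: inj; first exact: PP.
apply: (pointed_coneN K_pointed).
  by apply/PK/(KS _ _ ww0)/(KS _ _ ww)/PK.
have -> : - P (jrefl w0 (jrefl w (P b'))) =
    P (jrefl w0 (jrefl w (b' - P b'))).
  rewrite (linearB (jrefl w) b' (P b')) (linearB (jrefl w0) (jrefl w b')).
  by rewrite (linearB P (jrefl w0 (jrefl w b'))) /= {1}/b' !jreflK // Pb sub0r.
by apply/PK/(KS _ _ ww0)/(KS _ _ ww)/NK.
Qed.

(** Let [S] be the product of the two reflections, [u = s e] and [N = 1 - P]. Transport for [P]
    gives [P S (u - P u) = 0], that is [P S P u = P u] as [S u = u]; transport for [N] gives
    [S P u = P S P u]. *)
Lemma cone_projection_fixed P w0 w s : cone_projection P ->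
    w0 ** w0 = jone -> w ** w = jone ->
    (forall x, P x = x -> P (jrefl w0 (jrefl w x)) = 0 -> x = 0) ->
    (forall x, x - P x = x ->
       jrefl w0 (jrefl w x) - P (jrefl w0 (jrefl w x)) = 0 -> x = 0) ->
  K (s *: jone) ->
  jrefl w (jrefl w0 (P (s *: jone))) = P (s *: jone).
Proof.
move=> hP ww0 ww injP injN Ku; set u := s *: jone in Ku *.
have [N NE hN] := cone_projection_compl hP; have [PP PK NK] := hP.
have Su : jrefl w (jrefl w0 u) = u by rewrite /u !linearZ /= !jrefl1.
have h1 := cone_projection_transport hP ww0 ww injP (NK u Ku).
have h2 : N (jrefl w (jrefl w0 (P u))) = 0.
  apply: (cone_projection_transport hN ww0 ww) => [x||].
  - by rewrite !NE; exact: injN.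
  - exact: PK.
  - by rewrite NE PP subrr.
move: h1; rewrite (linearB P u (P u)) /= PP subrr => /(_ erefl).
rewrite (linearB (jrefl w0) u (P u)) (linearB (jrefl w) (jrefl w0 u)) /= Su.
rewrite (linearB P u) /= => /subr0_eq h3; rewrite [RHS]h3.
by move: h2; rewrite NE => /subr0_eq.
Qed.

Hypothesis V_simple : eja_simple V.

Lemma cone_projection_scalar P s : cone_projection P -> K (s *: jone) ->
  exists a, P (s *: jone) = a *: jone.
Proof.
move=> hP Ku; set a := P _.
have [N NE hN] := cone_projection_compl hP.
have [r [l [_ _ cc _ aE]]] := spectral_idempotents a.
have cE b : b \in r -> exists k, jpoly a (l b) = k *: jone.
  move=> br; set c := jpoly a (l b); have ic : jidempotent c.
    by have := cc b b br br; rewrite eqxx.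
  have [->|->] : c = 0 \/ c = jone; last by exists 1; rewrite scale1r.
    apply: (simple_idempotent V_simple ic) => x cx; apply: contrapT => /eqP x0.
    have ww := idem_inv ic; have wx := (odd_half c x).2 cx.
    have [v [v0 wv vv]] := odd_tripotent ww wx x0.
    have cv := (odd_half c v).1 wv.
    have [b0 [b1 [b2 [wt b0c wc]]]] := tripotent_rotation ic v0 cv vv.
    have b00 : b0 ** b0 = jone.
      have := wt 0; rewrite /rot_inv expr0n /= !scale0r !addr0 expr1n scale1r.
      exact.
    have [p p0 hp] := rotation_injective P b1 b2 b00.
    have [q q0 hq] := rotation_injective N b1 b2 b00.
    (* A non-root [t] makes the rotation injective in the required sense for both [P] and [N], and
       satisfies [t != 0] and [t^2 != 1], so that [c] moves. *)
    have d0 : p * q * ('X * ('X ^+ 2 - 1)) != 0.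
      rewrite !mulf_neq0 ?polyX_eq0 //.
      by rewrite -size_poly_gt0 -['X ^+ 2]/'X^2 size_XnsubC.
    have [t] := poly_nonroot d0.
    rewrite !hornerM hornerD hornerN hornerXn hornerX hornerC !mulf_eq0 !negb_or.
    rewrite subr_eq0 => /andP[/andP[pt qt] /andP[t0 t1]].
    apply: (wc t t0 t1); set w := _ *: _.
    have r0 : 1 + t ^+ 2 != 0 by rewrite gt_eqF // ltr_wpDr ?sqr_ge0.
    have www : w ** w = jone.
      rewrite /w jmulZl jmulZr wt !scalerA -[RHS]scale1r; congr (_ *: _).
      by field.
    have fa : jrefl w (jrefl b0 a) = a.
      apply: cone_projection_fixed => //; first by move=> y; exact: hp.
      by move=> y; rewrite -!NE; exact: hq.
    (* [c] is a polynomial in [a], so it is fixed along with [a]. *)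
    by rewrite -[in LHS]b0c /c !jrefl_jpoly // fa.
  by exists 0; rewrite scale0r.
have /choice[k hk] : forall b, exists z, b \in r -> jpoly a (l b) = z *: jone.
  move=> b; have [br|nbr] := boolP (b \in r); last by exists 0.
  by have [z hz] := cE b br; exists z.
exists (\sum_(b <- r) b * k b); rewrite aE scaler_suml.
by apply: eq_big_seq => b br; rewrite hk // scalerA.
Qed.

Lemma cone_projection_trivial P s : s != 0 -> cone_projection P ->
  K (s *: jone) -> P jone = 0 \/ P jone = jone.
Proof.
move=> s0 hP Ku; have [a] := cone_projection_scalar hP Ku; have [PP _ _] := hP.
rewrite linearZ => Pe; have {}Pe : P jone = (a / s) *: jone.
  rewrite mulrC -scalerA -Pe scalerA mulVf ?scale1r //.
have := PP jone; rewrite Pe linearZ /= Pe scalerA => /eqP.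
rewrite -subr_eq0 -scalerBl scaler_eq0.
set b := a / s; have -> : b * b - b = b * (b - 1) by ring.
rewrite mulf_eq0 subr_eq0 => /orP[/orP[/eqP->|/eqP->]|/eqP->].
- by left; rewrite scale0r.
- by right; rewrite scale1r.
- by left; rewrite scaler0.
Qed.

Lemma cone_projection0 P : cone_projection P -> P jone = 0 ->
  forall x, K x -> P x = 0.
Proof.
move=> [PP PK _] Pe x Kx.
have [y [s [Ky e]]] := spectral_cone_trace V_rank K_spectral cK (PK x Kx).
apply: (pointed_coneN K_pointed); first exact: PK.
have -> : - P x = P y.
  have := congr1 P e; rewrite linearD linearZ /= PP Pe scaler0 => /eqP.
  by rewrite addrC addr_eq0 => /eqP ->.
exact: PK.
Qed.

End DecomposedCone.

Theorem theorem5p1 (R : realType) (V : euclideanJordanType R) (n : nat)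
    (V_simple : eja_simple V) (V_rank : eja_rank V n)
    (K : set V) (K_spectral : spectral_cone n K) (K_pointed : pointed_cone K) :
  irreducible_cone K.
Proof.
have cK : convex_cone K := proj1 K_pointed.
split=> // -[_ [K1 [K2 [[cK1 K1n0] [cK2 K2n0] K12 KE]]]].
have [U1 U1E] := span_set_vspace K1; have [U2 U2E] := span_set_vspace K2.
have KU (L : set V) (U : {vspace V}) (hU : forall x, span_set L x <-> x \in U) x :
    L x -> x \in U.
  move=> Lx; apply/hU; exists [:: x]; last by rewrite memv_span // inE.
  by move=> y; rewrite inE => /eqP ->.
have cap : (U1 :&: U2 = 0)%VS.
  apply/eqP; rewrite -subv0; apply/subvP => x; rewrite memv_cap memv0.
  move=> /andP[/U1E x1 /U2E x2]; apply/eqP.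
  suff : [set 0] x by [].
  by rewrite -K12.
have K1K x : K1 x -> K x.
  by move=> K1x; rewrite KE; exists x => //; exists 0; [exact: cone0|rewrite addr0].
have K2K x : K2 x -> K x.
  by move=> K2x; rewrite KE; exists 0; [exact: cone0|exists x; rewrite ?add0r].
pose P : {linear V -> V} := daddv_pi U1 U2.
have P1 x : x \in U1 -> P x = x by exact: daddv_pi_id.
have P2 x : x \in U2 -> P x = 0.
  move=> x2; have := daddv_pi_add cap (subvP (addvSr U1 U2) _ x2).
  rewrite [daddv_pi U2 U1 x]daddv_pi_id 1?capvC // => /eqP.
  by rewrite -subr_eq0 addrK => /eqP.
have Psum x y : K1 x -> K2 y -> P (x + y) = x.
  by move=> /(KU _ _ U1E) x1 /(KU _ _ U2E) y2; rewrite linearD /= P1 // P2 // addr0.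
have hP : cone_projection K P.
  split=> x; first by apply: P1; exact: memv_pi.
  - by rewrite {1}KE => -[y K1y [z K2z <-]]; rewrite Psum //; exact: K1K.
  - rewrite {1}KE => -[y K1y [z K2z <-]]; rewrite Psum // addrAC subrr add0r.
    exact: K2K.
have nz (L : set V) : convex_cone L -> L <> [set 0] -> exists2 x, L x & x != 0.
  move=> cL Ln0; apply: contrapT => h; apply: Ln0; apply/seteqP; split=> x /=.
    by move=> Lx; apply: contrapT => /eqP x0; apply: h; exists x.
  by move=> ->; exact: cone0.
have [x1 K1x1 x10] := nz _ cK1 K1n0; have [x2 K2x2 x20] := nz _ cK2 K2n0.
have [y [s [Ky xy]]] := spectral_cone_trace V_rank K_spectral cK (K1K _ K1x1).
(* Otherwise [y = - x1] would lie in [K] together with [x1]. *)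
have s0 : s != 0.
  apply: contra x10 => /eqP s0; apply/eqP/(pointed_coneN K_pointed (K1K _ K1x1)).
  have /eqP := xy; rewrite s0 scale0r addrC addr_eq0 => /eqP <-.
  exact: Ky.
have Ku : K (s *: jone) by rewrite -xy; apply: coneD => //; exact: K1K.
have [Pe|Pe] :=
  cone_projection_trivial V_rank K_spectral K_pointed V_simple s0 hP Ku.
  have := cone_projection0 V_rank K_spectral K_pointed hP Pe (K1K _ K1x1).
  by rewrite P1 ?(KU _ _ U1E) // => /eqP; rewrite (negPf x10).
have [N NE hN] := cone_projection_compl hP.
have Ne : N jone = 0 by rewrite NE Pe subrr.
have := cone_projection0 V_rank K_spectral K_pointed hN Ne (K2K _ K2x2).
by rewrite NE P2 ?(KU _ _ U2E) // subr0 => /eqP; rewrite (negPf x20).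
Qed.
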